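(* Let $\mathfrak I$ be a homological ideal in a triangulated category $\mathfrak T$. Let $A\in\mathfrak T$ have an $\mathfrak I$-projective resolution of length $1$, that is, of the form $0\to P_1\to P_0\to A$. Suppose also that $\mathfrak T(A,B)=0$ for all $\mathfrak I$-contractible objects $B$ of $\mathfrak T$. Let $F\colon\mathfrak T\to\mathfrak C$ be a homological functor, $\tilde F\colon\mathfrak T^{\mathrm{op}}\to\mathfrak C$ a cohomological functor (with $\mathfrak C$ Abelian), and $B\in\mathfrak T$. Then there are natural short exact sequences $$0\to\mathbb L_0F_*(A)\to F_*(A)\to\mathbb L_1F_{*-1}(A)\to0,$$ $$0\to\mathbb R^1\tilde F^{*-1}(A)\to\tilde F^*(A)\to\mathbb R^0\tilde F^*(A)\to0,$$ $$0\to\mathrm{Ext}^1_{\mathfrak T,\mathfrak I}(\Sigma A,B)\to\mathfrak T(A,B)\to\mathrm{Ext}^0_{\mathfrak T,\mathfrak I}(A,B)\to0.$$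
   Context: $\mathfrak T(A,B)$ denotes the group of morphisms; $\Sigma$ is the suspension. An ideal $\mathfrak I$ is a family of subgroups $\mathfrak I(A,B)\subseteq\mathfrak T(A,B)$ closed under composition with arbitrary morphisms on both sides. A covariant additive functor $F\colon\mathfrak T\to\mathfrak C$ into an Abelian category is homological if $F(A)\to F(B)\to F(C)$ is exact at $F(B)$ for every exact triangle $A\to B\to C\to\Sigma A$; cohomological is the analogous notion for contravariant functors. It is stable homological if $\mathfrak C$ carries an automorphism $\Sigma$ and $F(\Sigma A)\cong\Sigma F(A)$ naturally. A homological ideal is an ideal of the form $\ker K$, $\ker K(A,B)=\{f\in\mathfrak T(A,B)\mid K(f)=0\}$, for a stable homological functor $K$. Notation: $F_n(A)=F(\Sigma^{-n}A)$ and $\tilde F^n(A)=\tilde F(\Sigma^{-n}A)$ for $n\in\mathbb Z$. An object $B$ is $\mathfrak I$-contractible if $\mathrm{id}_B\in\mathfrak I(B,B)$. An object $P$ is $\mathfrak I$-projective if $\mathfrak T(P,f)=0$ for all $f\in\mathfrak I$. A chain complex $(C_n,d_n)$ over $\mathfrak T$ is $\mathfrak I$-exact if, for all $n$, with exact triangles $C_n\xrightarrow{d_n}C_{n-1}\xrightarrow{f_n}X_n\xrightarrow{g_n}\Sigma C_n$, one has $\Sigma f_{n+1}\circ g_n\in\mathfrak I(X_n,\Sigma X_{n+1})$. An $\mathfrak I$-projective resolution of $A$ is an $\mathfrak I$-exact chain complex $\cdots\to P_1\to P_0\to A\to0$ with all $P_n$ $\mathfrak I$-projective; it is unique up to chain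 homotopy equivalence. The derived functors at an object with an $\mathfrak I$-projective resolution $P_\bullet$ are: $\mathbb L_nF(A)$ is the $n$th homology of $\cdots\to F(P_1)\to F(P_0)\to0$; for contravariant $\tilde F$, $\mathbb R^n\tilde F(A)$ is the $n$th cohomology of $0\to\tilde F(P_0)\to\tilde F(P_1)\to\cdots$; $\mathrm{Ext}^n_{\mathfrak T,\mathfrak I}(\cdot,B)$ is the $n$th right derived functor of $A\mapsto\mathfrak T(A,B)$. Naturality in $A$ refers to morphisms between objects satisfying the hypotheses imposed on $A$. *)

(* Defs.v *)
From HB Require Import structures.
From mathcomp Require Import all_boot all_order all_algebra.
From mathcomp Require Import boolp classical_sets.

Set Implicit Arguments.
Unset Strict Implicit.
Unset Printing Implicit Defensive.

Import GRing.Theory.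
Local Open Scope ring_scope.
Local Open Scope quotient_scope.

Declare Scope cat_scope.
Delimit Scope cat_scope with C.
Local Open Scope cat_scope.

Reserved Notation "g \oc f" (at level 40, left associativity).

Record addcat := AddCat {
  obj :> Type;
  mor : obj -> obj -> zmodType;
  idm : forall A, mor A A;
  compm : forall A B C, mor B C -> mor A B -> mor A C;
  compA : forall A B C D (h : mor C D) (g : mor B C) (f : mor A B),
    compm h (compm g f) = compm (compm h g) f;
  comp1m : forall A B (f : mor A B), compm (idm B) f = f;
  compm1 : forall A B (f : mor A B), compm f (idm A) = f;
  compmDl : forall A B C (g g' : mor B C) (f : mor A B),
    compm (g + g') f = compm g f + compm g' f;
  compmDr : forall A B C (g : mor B C) (f f' : mor A B),
    compm g (f + f') = compm g f + compm g f';
  zobj : obj;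
  zobjP : idm zobj = 0;
  biprodP : forall A B : obj,
    exists (S : obj) (i : mor A S) (j : mor B S) (p : mor S A) (q : mor S B),
      [/\ compm p i = idm A, compm q j = idm B, compm p j = 0, compm q i = 0
        & compm i p + compm j q = idm S] }.

Arguments mor {_} _ _.
Arguments idm {_} _.
Arguments compm {_ _ _ _} _ _.
Arguments zobj {_}.

Notation "g \oc f" := (compm g f) : cat_scope.

Definition is_zobj (T : addcat) (A : T) : Prop := idm A = 0.

Definition isom (T : addcat) (A B : T) (f : mor A B) : Prop :=
  exists g : mor B A, g \oc f = idm A /\ f \oc g = idm B.

Lemma op_biprodP (T : addcat) (A B : T) :
  exists (S : T) (i : mor S A) (j : mor S B) (p : mor A S) (q : mor B S),
    [/\ i \oc p = idm A, j \oc q = idm B, j \oc p = 0, i \oc q = 0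
      & p \oc i + q \oc j = idm S].
Proof.
by have [S [i [j [p [q [? ? ? ? ?]]]]]] := biprodP A B; exists S, p, q, i, j.
Qed.

Definition op (T : addcat) : addcat :=
  @AddCat T (fun A B => @mor T B A) (@idm T) (fun A B C g f => f \oc g)
    (fun A B C D h g f => esym (compA f g h))
    (fun A B f => compm1 f) (fun A B f => comp1m f)
    (fun A B C g g' f => compmDr f g g') (fun A B C g f f' => compmDl f f' g)
    zobj (zobjP T) (@op_biprodP T).

Record functor (T U : addcat) := Functor {
  fobj :> T -> U;
  fmor : forall A B : T, mor A B -> mor (fobj A) (fobj B);
  fmor1 : forall A : T, fmor (idm A) = idm (fobj A);
  fmorM : forall (A B C : T) (g : mor B C) (f : mor A B),
    fmor (g \oc f) = fmor g \oc fmor f;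
  fmorD : forall (A B : T) (f g : mor A B), fmor (f + g) = fmor f + fmor g }.

Arguments fmor {T U} _ {A B} _.

Definition fid (T : addcat) : functor T T :=
  @Functor T T id (fun A B f => f) (fun A => erefl) (fun A B C g f => erefl)
    (fun A B f g => erefl).

Section FunctorComposition.
Variables (T U V : addcat) (G : functor U V) (F : functor T U).

Let fcomp_mor (A B : T) (f : mor A B) : mor (G (F A)) (G (F B)) :=
  fmor G (fmor F f).

Lemma fcomp1 (A : T) : fcomp_mor (idm A) = idm (G (F A)).
Proof. by rewrite /fcomp_mor !fmor1. Qed.

Lemma fcompM (A B C : T) (g : mor B C) (f : mor A B) :
  fcomp_mor (g \oc f) = fcomp_mor g \oc fcomp_mor f.
Proof. by rewrite /fcomp_mor !fmorM. Qed.

Lemma fcompD (A B : T) (f g : mor A B) :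
  fcomp_mor (f + g) = fcomp_mor f + fcomp_mor g.
Proof. by rewrite /fcomp_mor !fmorD. Qed.

Definition fcomp : functor T V := Functor fcomp1 fcompM fcompD.

End FunctorComposition.

Definition fop (T U : addcat) (F : functor T U) : functor (op T) (op U) :=
  @Functor (op T) (op U) F (fun A B f => fmor F f) (fmor1 F)
    (fun A B C g f => fmorM F f g) (fun A B f g => fmorD F f g).

Definition comor (T U : addcat) (F : functor (op T) U) (A B : T)
    (f : mor A B) : mor (F B) (F A) :=
  @fmor (op T) U F B A f.

Definition natural_iso (T U : addcat) (F G : functor T U) : Prop :=
  exists t : forall A : T, mor (F A) (G A),
    (forall A, isom (t A)) /\
    (forall (A B : T) (f : mor A B), t B \oc fmor F f = fmor G f \oc t A).

(** [S] and [S'] are mutually inverse automorphisms: both composites are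
    equal, as functors, to the identity. *)
Definition inverse_functors (T : addcat) (S S' : functor T T) : Prop :=
  fcomp S S' = fid T /\ fcomp S' S = fid T.

Definition mono (T : addcat) (A B : T) (f : mor A B) : Prop :=
  forall (X : T) (x y : mor X A), f \oc x = f \oc y -> x = y.

Definition epi (T : addcat) (A B : T) (f : mor A B) : Prop :=
  forall (X : T) (x y : mor B X), x \oc f = y \oc f -> x = y.

Definition is_kernel (T : addcat) (A B K : T) (f : mor A B) (k : mor K A) :=
  f \oc k = 0 /\
  forall (X : T) (h : mor X A), f \oc h = 0 -> exists! x : mor X K, k \oc x = h.

Definition is_cokernel (T : addcat) (A B Q : T) (f : mor A B) (q : mor B Q) :=
  q \oc f = 0 /\
  forall (X : T) (h : mor B X), h \oc f = 0 -> exists! x : mor Q X, x \oc q = h.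

Record abelian := Abelian {
  acat :> addcat;
  has_kernel : forall (A B : acat) (f : mor A B),
    exists (K : acat) (k : mor K A), is_kernel f k;
  has_cokernel : forall (A B : acat) (f : mor A B),
    exists (Q : acat) (q : mor B Q), is_cokernel f q;
  mono_normal : forall (A B : acat) (f : mor A B), mono f ->
    exists (C : acat) (g : mor B C), is_kernel g f;
  epi_normal : forall (A B : acat) (f : mor A B), epi f ->
    exists (C : acat) (g : mor C A), is_cokernel g f }.

Section AbelianTheory.
Variable C : abelian.

Definition ker (A B : C) (f : mor A B) : C := projT1 (cid (has_kernel f)).
Definition kerm (A B : C) (f : mor A B) : mor (ker f) A :=
  projT1 (cid (projT2 (cid (has_kernel f)))).

Lemma kermP (A B : C) (f : mor A B) : is_kernel f (kerm f).
Proof. exact: projT2 (cid (projT2 (cid (has_kernel f)))). Qed.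

Definition coker (A B : C) (f : mor A B) : C := projT1 (cid (has_cokernel f)).
Definition cokerm (A B : C) (f : mor A B) : mor B (coker f) :=
  projT1 (cid (projT2 (cid (has_cokernel f)))).

Lemma cokermP (A B : C) (f : mor A B) : is_cokernel f (cokerm f).
Proof. exact: projT2 (cid (projT2 (cid (has_cokernel f)))). Qed.

(** The factorisations through a kernel and a cokernel; their values are junk
    (zero) when [h] does not satisfy the required equation. *)
Definition ker_lift (A B X : C) (f : mor A B) (h : mor X A) : mor X (ker f) :=
  xget 0 [set x | kerm f \oc x = h].
Definition coker_desc (A B X : C) (f : mor A B) (h : mor B X) :
    mor (coker f) X :=
  xget 0 [set x | x \oc cokerm f = h].

Lemma ker_liftP (A B X : C) (f : mor A B) (h : mor X A) :
  f \oc h = 0 -> kerm f \oc ker_lift f h = h.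
Proof.
move=> fh; have [_ /(_ _ _ fh) [x [xh _]]] := kermP f.
by rewrite /ker_lift; case: xgetP => [y _ //|/(_ x)]; case.
Qed.

Lemma coker_descP (A B X : C) (f : mor A B) (h : mor B X) :
  h \oc f = 0 -> coker_desc f h \oc cokerm f = h.
Proof.
move=> fh; have [_ /(_ _ _ fh) [x [xh _]]] := cokermP f.
by rewrite /coker_desc; case: xgetP => [y _ //|/(_ x)]; case.
Qed.

Definition imm (A B : C) (f : mor A B) : mor (ker (cokerm f)) B :=
  kerm (cokerm f).

(** Exactness of [A -f-> B -g-> D] at [B]: the image of [f] is the kernel
    of [g]. *)
Definition exact_at (A B D : C) (f : mor A B) (g : mor B D) : Prop :=
  is_kernel g (imm f).

Definition short_exact (A B D : C) (f : mor A B) (g : mor B D) : Prop :=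
  [/\ exact_at (0 : mor zobj A) f, exact_at f g & exact_at g (0 : mor D zobj)].

(** [ker g / im f], for [A -f-> B -g-> D] with [g \oc f = 0]. *)
Definition homology (A B D : C) (f : mor A B) (g : mor B D) : C :=
  coker (ker_lift g f).

(** The map on homology induced by the middle component [t] of a morphism from
    [A -f-> B -g-> D] to [A' -f'-> B' -g'-> D']. *)
Definition homology_map (A B D A' B' D' : C) (f : mor A B) (g : mor B D)
    (f' : mor A' B') (g' : mor B' D') (t : mor B B') :
    mor (homology f g) (homology f' g') :=
  coker_desc (ker_lift g f)
    (cokerm (ker_lift g' f') \oc ker_lift g' (t \oc kerm g)).

(** Homology of [... -> G 1 -> G 0 -> 0]. *)
Section ChainHomology.
Variables (G : nat -> C) (d : forall n, mor (G n.+1) (G n)).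

Definition dout (n : nat) : mor (G n) (if n is m.+1 then G m else zobj) :=
  match n return mor (G n) (if n is m.+1 then G m else zobj) with
  | 0 => 0
  | m.+1 => d m
  end.

Definition chain_homology (n : nat) : C := homology (d n) (dout n).

End ChainHomology.

Definition chain_homology_map (G G' : nat -> C)
    (d : forall n, mor (G n.+1) (G n)) (d' : forall n, mor (G' n.+1) (G' n))
    (t : forall n, mor (G n) (G' n)) (n : nat) :
    mor (chain_homology d n) (chain_homology d' n) :=
  homology_map (d n) (dout d n) (d' n) (dout d' n) (t n).

(** Cohomology of [0 -> G 0 -> G 1 -> ...]. *)
Section CochainCohomology.
Variables (G : nat -> C) (d : forall n, mor (G n) (G n.+1)).

Definition din (n : nat) : mor (if n is m.+1 then G m else zobj) (G n) :=
  match n return mor (if n is m.+1 then G m else zobj) (G n) with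
  | 0 => 0
  | m.+1 => d m
  end.

Definition cochain_cohomology (n : nat) : C := homology (din n) (d n).

End CochainCohomology.

Definition cochain_cohomology_map (G G' : nat -> C)
    (d : forall n, mor (G n) (G n.+1)) (d' : forall n, mor (G' n) (G' n.+1))
    (t : forall n, mor (G n) (G' n)) (n : nat) :
    mor (cochain_cohomology d n) (cochain_cohomology d' n) :=
  homology_map (din d n) (d n) (din d' n) (d' n) (t n).

End AbelianTheory.

Record addhom (U V : zmodType) := AddHom {
  addhom_fun :> U -> V;
  addhomB : forall x y, addhom_fun (x - y) = addhom_fun x - addhom_fun y }.

Section AddHomZmodule.
Variables U V : zmodType.
Implicit Types f g : addhom U V.

Lemma addhomP f g : f =1 g -> f = g.
Proof.
case: f g => f fB [g gB] /= fg; have {}fg : f = g by apply/funext.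
by case: _ / fg gB => gB; congr AddHom; exact: Prop_irrelevance.
Qed.

Lemma addhom0 f : f 0 = 0.
Proof. by rewrite -[0 in LHS](subrr 0) addhomB subrr. Qed.

Lemma addhomN f x : f (- x) = - f x.
Proof. by rewrite -[- x]sub0r addhomB addhom0 sub0r. Qed.

Lemma addhomD f x y : f (x + y) = f x + f y.
Proof. by rewrite -[y in LHS]opprK addhomB addhomN opprK. Qed.

Let zero_subproof (x y : U) : (0 : V) = 0 - 0.
Proof. by rewrite subrr. Qed.
Let opp_subproof f x y : - f (x - y) = - f x - - f y.
Proof. by rewrite addhomB opprB opprK addrC. Qed.
Let add_subproof f g x y : f (x - y) + g (x - y) = f x + g x - (f y + g y).
Proof. by rewrite !addhomB opprD addrACA. Qed.

Definition addhom_zero := AddHom zero_subproof.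
Definition addhom_opp f := AddHom (opp_subproof f).
Definition addhom_add f g := AddHom (add_subproof f g).

HB.instance Definition _ := gen_eqMixin (addhom U V).
HB.instance Definition _ := gen_choiceMixin (addhom U V).

Let addA : associative addhom_add.
Proof. by move=> f g h; apply: addhomP => x /=; rewrite addrA. Qed.
Let addC : commutative addhom_add.
Proof. by move=> f g; apply: addhomP => x /=; rewrite addrC. Qed.
Let add0 : left_id addhom_zero addhom_add.
Proof. by move=> f; apply: addhomP => x /=; rewrite add0r. Qed.
Let addN : left_inverse addhom_zero addhom_opp addhom_add.
Proof. by move=> f; apply: addhomP => x /=; rewrite addNr. Qed.

HB.instance Definition _ := GRing.isZmodule.Build (addhom U V) addA addC add0 addN.

End AddHomZmodule.

Section AbCategory.

Definition addhom_id (U : zmodType) : addhom U U :=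
  @AddHom U U id (fun x y => erefl).

Lemma addhom_comp_subproof (U V W : zmodType) (g : addhom V W) (f : addhom U V)
  x y : g (f (x - y)) = g (f x) - g (f y).
Proof. by rewrite !addhomB. Qed.

Definition addhom_comp (U V W : zmodType) (g : addhom V W) (f : addhom U V) :=
  AddHom (addhom_comp_subproof g f).

Lemma addhom_compA (U V W X : zmodType) (h : addhom W X) (g : addhom V W)
    (f : addhom U V) :
  addhom_comp h (addhom_comp g f) = addhom_comp (addhom_comp h g) f.
Proof. exact: addhomP. Qed.

Lemma addhom_comp1m (U V : zmodType) (f : addhom U V) :
  addhom_comp (addhom_id V) f = f.
Proof. exact: addhomP. Qed.

Lemma addhom_compm1 (U V : zmodType) (f : addhom U V) :
  addhom_comp f (addhom_id U) = f.
Proof. exact: addhomP. Qed.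

Lemma addhom_compDl (U V W : zmodType) (g g' : addhom V W) (f : addhom U V) :
  addhom_comp (g + g') f = addhom_comp g f + addhom_comp g' f.
Proof. exact: addhomP. Qed.

Lemma addhom_compDr (U V W : zmodType) (g : addhom V W) (f f' : addhom U V) :
  addhom_comp g (f + f') = addhom_comp g f + addhom_comp g f'.
Proof. by apply: addhomP => x; exact: addhomD. Qed.

Lemma Ab_zobjP : addhom_id 'rV[int]_0 = 0.
Proof. by apply: addhomP => x; rewrite [LHS]thinmx0 [RHS]thinmx0. Qed.

Lemma Ab_biprodP (A B : zmodType) :
  exists (S : zmodType) (i : addhom A S) (j : addhom B S) (p : addhom S A)
    (q : addhom S B),
    [/\ addhom_comp p i = addhom_id A, addhom_comp q j = addhom_id B,
        addhom_comp p j = 0, addhom_comp q i = 0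
      & addhom_comp i p + addhom_comp j q = addhom_id S].
Proof.
have iB (x y : A) : (x - y, 0) = (x, 0) - (y, 0) :> A * B.
  by congr pair; rewrite /= subrr.
have jB (x y : B) : (0, x - y) = (0, x) - (0, y) :> A * B.
  by congr pair; rewrite /= subrr.
exists (A * B)%type, (AddHom iB), (AddHom jB),
  (@AddHom (A * B)%type A fst (fun x y => erefl)),
  (@AddHom (A * B)%type B snd (fun x y => erefl)).
split; apply: addhomP => //= -[x y]; congr pair; exact/addr0 || exact/add0r.
Qed.

Definition Ab_cat : addcat :=
  @AddCat zmodType (fun U V => addhom U V) addhom_id addhom_comp
    addhom_compA addhom_comp1m addhom_compm1 addhom_compDl addhom_compDr
    'rV[int]_0 Ab_zobjP Ab_biprodP.

Section Kernel.
Variables (A B : zmodType) (f : addhom A B).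

Definition kpred : {pred A} := fun x => f x == 0.

Fact kpred_closed : zmod_closed kpred.
Proof.
split=> [|x y]; rewrite !unfold_in ?addhom0 //.
by move=> /eqP fx /eqP fy; rewrite addhomB fx fy subrr.
Qed.

HB.instance Definition _ := GRing.isZmodClosed.Build A kpred kpred_closed.

Record ksub := KSub { ksub_val :> A; _ : ksub_val \in kpred }.
HB.instance Definition _ := [isSub for ksub_val].
HB.instance Definition _ := [Choice of ksub by <:].
HB.instance Definition _ := [SubChoice_isSubZmodule of ksub by <:].

Definition kincl : addhom ksub A := @AddHom ksub A ksub_val (fun x y => erefl).

Lemma kinclP : @is_kernel Ab_cat A B ksub f kincl.
Proof.
split=> [|X h fh].
  by apply: addhomP => -[x /= ]; rewrite unfold_in => /eqP.
have hk x : h x \in kpred.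
  by rewrite unfold_in; apply/eqP; exact: (congr1 (fun g : addhom X B => g x) fh).
have hB x y : KSub (hk (x - y)) = KSub (hk x) - KSub (hk y).
  by apply: val_inj; exact: addhomB.
exists (AddHom hB); split=> [|g gh]; first exact: addhomP.
apply: addhomP => x; apply: val_inj => /=.
by rewrite -[h]gh.
Qed.

End Kernel.

Section Cokernel.
Variables (A B : zmodType) (f : addhom A B).

Definition ipred : {pred B} := fun y => `[< exists x, f x = y >].

Fact ipred_closed : zmod_closed ipred.
Proof.
split=> [|y z]; rewrite !unfold_in.
  by apply/asboolP; exists 0; rewrite addhom0.
move=> /asboolP[x <-] /asboolP[x' <-]; apply/asboolP.
by exists (x - x'); rewrite addhomB.
Qed.

HB.instance Definition _ := GRing.isZmodClosed.Build B ipred ipred_closed.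

Definition iideal : zmodClosed B := ipred.
Definition iquot : zmodType := {ideal_quot iideal}.

Lemma iproj_subproof (x y : B) :
  \pi_{ideal_quot iideal} (x - y) = \pi x - \pi y :> iquot.
Proof. exact: raddfB. Qed.

Definition iproj : addhom B iquot :=
  @AddHom B iquot \pi_{ideal_quot iideal} iproj_subproof.

Lemma iproj_eq (x y : B) : iproj x = iproj y <-> exists z, f z = x - y.
Proof.
rewrite /=; split=> [/eqP|[z fz]].
  by rewrite -Quotient.idealrBE unfold_in => /asboolP.
by apply/eqP; rewrite -Quotient.idealrBE unfold_in; apply/asboolP; exists z.
Qed.

Lemma iproj_surj (q : iquot) : exists x, iproj x = q.
Proof. by exists (repr (q : {ideal_quot iideal})); rewrite /= reprK. Qed.

Lemma iprojP : @is_cokernel Ab_cat A B iquot f iproj.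
Proof.
split=> [|X h hf].
  apply: addhomP => x; rewrite -[RHS](addhom0 iproj).
  by apply/iproj_eq; exists x; rewrite subr0.
have hE x y : iproj x = iproj y -> h x = h y.
  move=> /iproj_eq[z fz]; apply/eqP; rewrite -subr_eq0 -addhomB -fz.
  by apply/eqP; exact: (congr1 (fun g : addhom A X => g z) hf).
have hq x : h (repr (iproj x)) = h x by apply: hE; rewrite /= reprK.
have hB (p q : iquot) : h (repr (p - q)) = h (repr p) - h (repr q).
  have [[x <-] [y <-]] := (iproj_surj p, iproj_surj q).
  by rewrite -addhomB !hq addhomB.
exists (AddHom hB); split=> [|g gh]; first by apply: addhomP.
by apply: addhomP => q; have [x <-] := iproj_surj q; rewrite /= hq -[h]gh.
Qed.

End Cokernel.

Lemma Ab_has_kernel (A B : Ab_cat) (f : mor A B) :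
  exists (K : Ab_cat) (k : mor K A), is_kernel f k.
Proof. by exists (ksub f : zmodType), (kincl f); exact: kinclP. Qed.

Lemma Ab_has_cokernel (A B : Ab_cat) (f : mor A B) :
  exists (Q : Ab_cat) (q : mor B Q), is_cokernel f q.
Proof. by exists (iquot f), (iproj f); exact: iprojP. Qed.

Lemma Ab_mono_normal (A B : Ab_cat) (f : mor A B) : mono f ->
  exists (C : Ab_cat) (g : mor B C), is_kernel g f.
Proof.
move=> fm; have f_inj (x : A) : (f : addhom A B) x = 0 -> x = 0.
  move=> fx; have xk : x \in kpred f by rewrite unfold_in fx.
  have /fm/(congr1 (fun g : addhom (ksub f) A => g (KSub xk))) // :
    @compm Ab_cat (ksub f) A B f (kincl f) = @compm Ab_cat (ksub f) A B f 0.
  apply: addhomP => -[y /= yk]; rewrite addhom0; apply/eqP.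
  by move: yk; rewrite unfold_in.
exists (iquot f), (iproj f); split; first by case: (iprojP f).
move=> X h hf.
have hP x : exists y, (f : addhom A B) y = (h : addhom X B) x.
  have : iproj f ((h : addhom X B) x) = iproj f 0.
    rewrite addhom0.
    exact: (congr1 (fun g : addhom X (iquot f) => g x) hf).
  by move=> /iproj_eq[z]; rewrite subr0; exists z.
have [s sP] := choice hP.
have sB x y : s (x - y) = s x - s y.
  apply/eqP; rewrite -subr_eq0; apply/eqP/f_inj.
  by rewrite addhomB addhomB !sP addhomB subrr.
exists (AddHom sB); split=> [|g gh]; first exact: addhomP.
apply: addhomP => x /=; apply/eqP; rewrite -subr_eq0; apply/eqP/f_inj.
by rewrite addhomB sP -[h]gh subrr.
Qed.

Lemma Ab_epi_normal (A B : Ab_cat) (f : mor A B) : epi f ->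
  exists (C : Ab_cat) (g : mor C A), is_cokernel g f.
Proof.
move=> fe; have f_surj (y : B) : exists x, (f : addhom A B) x = y.
  have /fe/(congr1 (fun g : addhom B (iquot f) => g y)) :
    @compm Ab_cat A B (iquot f) (iproj f) f = @compm Ab_cat A B (iquot f) 0 f.
    by case: (iprojP f) => -> _; exact: addhomP.
  rewrite -[RHS](addhom0 (iproj f)) => /iproj_eq[x fx].
  by exists x; rewrite fx subr0.
exists (ksub f : zmodType), (kincl f); split; first by case: (kinclP f).
move=> X h hk.
have [s sP] := choice f_surj.
have hE x y : (f : addhom A B) x = (f : addhom A B) y ->
    (h : addhom A X) x = (h : addhom A X) y.
  move=> fxy; have xk : x - y \in kpred f.
    by rewrite unfold_in addhomB fxy subrr.
  apply/eqP; rewrite -subr_eq0 -addhomB; apply/eqP.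
  exact: (congr1 (fun g : addhom (ksub f) X => g (KSub xk)) hk).
have hB x y : (h : addhom A X) (s (x - y)) =
    (h : addhom A X) (s x) - (h : addhom A X) (s y).
  by rewrite -addhomB; apply: hE; rewrite addhomB !sP.
exists (AddHom hB); split=> [|g gh].
  by apply: addhomP => x /=; apply: hE; rewrite sP.
by apply: addhomP => y /=; rewrite -[h]gh /= sP.
Qed.

Definition Ab : abelian :=
  Abelian Ab_has_kernel Ab_has_cokernel Ab_mono_normal Ab_epi_normal.

End AbCategory.

Section HomFunctor.
Variables (T : addcat) (B : T).

Lemma compmBl (A A' A'' : T) (g g' : mor A' A'') (f : mor A A') :
  (g - g') \oc f = g \oc f - g' \oc f.
Proof. by apply/eqP; rewrite eq_sym subr_eq -compmDl subrK. Qed.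

Definition precomp (A A' : op T) (f : @mor (op T) A A') :
    addhom (@mor T A B) (@mor T A' B) :=
  @AddHom (@mor T A B) (@mor T A' B) (fun g => @compm T A' A B g f)
    (fun g g' => @compmBl A' A B g g' f).

Lemma precomp1 (A : op T) : precomp (idm A) = addhom_id (@mor T A B).
Proof. by apply: addhomP => g; exact: compm1. Qed.

Lemma precompM (A A' A'' : op T) (g : mor A' A'') (f : mor A A') :
  precomp (g \oc f) = addhom_comp (precomp g) (precomp f).
Proof. by apply: addhomP => h; exact: compA. Qed.

Lemma precompD (A A' : op T) (f g : mor A A') :
  precomp (f + g) = precomp f + precomp g.
Proof. by apply: addhomP => h; exact: compmDr. Qed.

Definition homF : functor (op T) Ab :=
  @Functor (op T) Ab (fun A => @mor T A B) precomp precomp1 precompM precompD.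

End HomFunctor.

Record triangulated := Triangulated {
  tcat :> addcat;
  susp : functor tcat tcat;
  desusp : functor tcat tcat;
  suspP : inverse_functors susp desusp;
  exact_tri : forall A B C : tcat,
    mor A B -> mor B C -> mor C (susp A) -> Prop;
  tri_iso : forall (A B C A' B' C' : tcat)
    (u : mor A B) (v : mor B C) (w : mor C (susp A))
    (u' : mor A' B') (v' : mor B' C') (w' : mor C' (susp A'))
    (a : mor A A') (b : mor B B') (c : mor C C'),
    isom a -> isom b -> isom c ->
    u' \oc a = b \oc u -> v' \oc b = c \oc v -> w' \oc c = fmor susp a \oc w ->
    exact_tri u v w -> exact_tri u' v' w';
  tri_id : forall A : tcat, exact_tri (idm A) (0 : mor A zobj) 0;
  tri_cone : forall (A B : tcat) (u : mor A B),
    exists (C : tcat) (v : mor B C) (w : mor C (susp A)), exact_tri u v w;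
  tri_rot : forall (A B C : tcat)
    (u : mor A B) (v : mor B C) (w : mor C (susp A)),
    exact_tri u v w <-> exact_tri v w (- fmor susp u);
  tri_mor : forall (A B C A' B' C' : tcat)
    (u : mor A B) (v : mor B C) (w : mor C (susp A))
    (u' : mor A' B') (v' : mor B' C') (w' : mor C' (susp A'))
    (a : mor A A') (b : mor B B'),
    exact_tri u v w -> exact_tri u' v' w' -> u' \oc a = b \oc u ->
    exists c : mor C C', v' \oc b = c \oc v /\ w' \oc c = fmor susp a \oc w;
  tri_octa : forall (X Y Z U V W : tcat) (f : mor X Y) (g : mor Y Z)
    (f' : mor Y U) (f'' : mor U (susp X))
    (g' : mor Z W) (g'' : mor W (susp Y))
    (h' : mor Z V) (h'' : mor V (susp X)),
    exact_tri f f' f'' -> exact_tri g g' g'' -> exact_tri (g \oc f) h' h'' ->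
    exists (a : mor U V) (b : mor V W),
      [/\ exact_tri a b (fmor susp f' \oc g''),
          a \oc f' = h' \oc g, h'' \oc a = f'',
          b \oc h' = g' & g'' \oc b = fmor susp f \oc h''] }.

Arguments susp {_}.
Arguments desusp {_}.
Arguments exact_tri {_ _ _ _} _ _ _.

Definition spow (T : triangulated) (n : int) : functor T T :=
  match n with
  | Posz m => iter m (fcomp susp) (fid T)
  | Negz m => iter m.+1 (fcomp desusp) (fid T)
  end.

Definition homological (T : triangulated) (C : abelian) (F : functor T C) :=
  forall (X Y Z : T) (u : mor X Y) (v : mor Y Z) (w : mor Z (susp X)),
    exact_tri u v w -> exact_at (fmor F u) (fmor F v).

Definition cohomological (T : triangulated) (C : abelian)
    (F : functor (op T) C) :=
  forall (X Y Z : T) (u : mor X Y) (v : mor Y Z) (w : mor Z (susp X)),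
    exact_tri u v w ->
    exact_at (comor F v) (comor F u).

(** [F_n = F o Sigma^-n], for covariant and for contravariant [F]. *)
Definition shiftF (T : triangulated) (C : addcat) (F : functor T C) (n : int) :
    functor T C :=
  fcomp F (spow T (- n)).
Definition coshiftF (T : triangulated) (C : addcat) (F : functor (op T) C)
    (n : int) : functor (op T) C :=
  fcomp F (fop (spow T (- n))).

Record ideal (T : addcat) := Ideal {
  in_ideal : forall A B : T, mor A B -> Prop;
  ideal0 : forall A B : T, in_ideal (0 : mor A B);
  idealB : forall (A B : T) (f g : mor A B),
    in_ideal f -> in_ideal g -> in_ideal (f - g);
  idealM : forall (A B C D : T) (h : mor C D) (f : mor B C) (g : mor A B),
    in_ideal f -> in_ideal (h \oc f \oc g) }.

Arguments in_ideal {T} _ {A B} _.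

Definition homological_ideal (T : triangulated) (I : ideal T) : Prop :=
  exists (C : abelian) (S S' : functor C C) (K : functor T C),
    [/\ inverse_functors S S', homological K,
        natural_iso (fcomp K susp) (fcomp S K)
      & forall (A B : T) (f : mor A B), in_ideal I f <-> fmor K f = 0].

Section RelativeHomologicalAlgebra.
Variables (T : triangulated) (I : ideal T).

Definition contractible (B : T) : Prop := in_ideal I (idm B).

Definition projective (P : T) : Prop :=
  forall (B C : T) (f : mor B C), in_ideal I f ->
  forall g : mor P B, f \oc g = 0.

(** [zsucc n] is [n + 1]; unlike the latter it reduces on constructors. *)
Definition zsucc (n : int) : int :=
  match n with
  | Posz m => Posz m.+1
  | Negz 0 => Posz 0
  | Negz m.+1 => Negz m
  end.

Lemma zsuccE (n : int) : zsucc n = n + 1.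
Proof.
case: n => [n|[|n]] //=; first by rewrite -addn1 PoszD.
by rewrite !NegzE -[n.+2]addn1 PoszD opprD addrNK.
Qed.

(** [diff n] is the differential usually written [d_(n+1)]. *)
Record chain_complex := ChainComplex {
  cobj : int -> T;
  diff : forall n, mor (cobj (zsucc n)) (cobj n);
  diffK : forall n, diff n \oc diff (zsucc n) = 0 }.

Definition ideal_exact (C : chain_complex) : Prop :=
  forall (n : int) (X Y : T)
    (f : mor (cobj C n) X) (g : mor X (susp (cobj C (zsucc n))))
    (f' : mor (cobj C (zsucc n)) Y)
    (g' : mor Y (susp (cobj C (zsucc (zsucc n))))),
    exact_tri (diff C n) f g -> exact_tri (diff C (zsucc n)) f' g' ->
    in_ideal I (fmor susp f' \oc g).

(** Augmented complexes [... -> P 1 -> P 0 -> A -> 0]. *)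
Record augmented (A : T) := Augmented {
  pobj : nat -> T;
  pdiff : forall n, mor (pobj n.+1) (pobj n);
  paug : mor (pobj 0) A;
  pdiffK : forall n, pdiff n \oc pdiff n.+1 = 0;
  paugK : paug \oc pdiff 0 = 0 }.

Section AugmentedComplex.
Variables (A : T) (P : augmented A).

(** [A] sits in degree [-1 = Negz 0]. *)
Definition aug_obj (n : int) : T :=
  match n with
  | Posz m => pobj P m
  | Negz 0 => A
  | Negz _.+1 => zobj
  end.

Definition aug_diff (n : int) : mor (aug_obj (zsucc n)) (aug_obj n) :=
  match n return mor (aug_obj (zsucc n)) (aug_obj n) with
  | Posz m => pdiff P m
  | Negz 0 => paug P
  | Negz _.+1 => 0
  end.

Lemma aug_diffK (n : int) : aug_diff n \oc aug_diff (zsucc n) = 0.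
Proof.
case: n => [n|[|n]] /=; [exact: pdiffK | exact: paugK |].
by apply: (addrI (0 \oc aug_diff (zsucc (Negz n.+1)))); rewrite -compmDl !addr0.
Qed.

Definition aug_complex : chain_complex := ChainComplex aug_diffK.

End AugmentedComplex.

Record resolution (A : T) := Resolution {
  res_aug :> augmented A;
  res_proj : forall n, projective (pobj res_aug n);
  res_exact : ideal_exact (aug_complex res_aug) }.

Definition length_one (A : T) (P : resolution A) : Prop :=
  forall n, (2 <= n)%N -> is_zobj (pobj P n).

Definition lifts (A A' : T) (f : mor A A') (P : resolution A)
    (P' : resolution A') (t : forall n, mor (pobj P n) (pobj P' n)) : Prop :=
  (forall n, t n \oc pdiff P n = pdiff P' n \oc t n.+1) /\
  paug P' \oc t 0 = f \oc paug P.

(** Derived functors. The resolution is an argument: the value of a derived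
    functor at [A] is well defined up to canonical isomorphism, and its value at
    a morphism [f] is induced by any chain map lifting [f]. *)

Section Left.
Variables (C : abelian) (F : functor T C).

Definition leftD (n : nat) (A : T) (P : resolution A) : C :=
  chain_homology (fun n => fmor F (pdiff P n)) n.

Definition leftD_map (n : nat) (A A' : T) (P : resolution A)
    (P' : resolution A') (t : forall n, mor (pobj P n) (pobj P' n)) :
    mor (leftD n P) (leftD n P') :=
  chain_homology_map _ _ (fun n => fmor F (t n)) n.

End Left.

Section Right.
Variables (C : abelian) (F : functor (op T) C).

Definition rightD (n : nat) (A : T) (P : resolution A) : C :=
  cochain_cohomology (fun n => comor F (pdiff P n)) n.

Definition rightD_map (n : nat) (A A' : T) (P : resolution A)
    (P' : resolution A') (t : forall n, mor (pobj P n) (pobj P' n)) :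
    mor (rightD n P') (rightD n P) :=
  cochain_cohomology_map _ _ (fun n => comor F (t n)) n.

End Right.

Definition Ext (n : nat) (A : T) (P : resolution A) (B : T) : Ab :=
  rightD (homF B) n P.

Definition Ext_map (n : nat) (A A' : T) (P : resolution A)
    (P' : resolution A') (B : T) (t : forall n, mor (pobj P n) (pobj P' n)) :
    mor (Ext n P' B) (Ext n P B) :=
  @rightD_map Ab (homF B) n A A' P P' t.

Definition uct_object (A : T) : Prop :=
  (exists P : resolution A, length_one P) /\
  (forall B : T, contractible B -> forall f : mor A B, f = 0).

End RelativeHomologicalAlgebra.

Arguments uct_object {T} I A.
Arguments lifts {T I A A'} f P P' t.
Arguments leftD {T I C} F n {A} P.
Arguments leftD_map {T I C} F n {A A'} P P' t.
Arguments rightD {T I C} F n {A} P.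
Arguments rightD_map {T I C} F n {A A'} P P' t.
Arguments Ext {T I} n {A} P B.
Arguments Ext_map {T I} n {A A'} P P' B t.

(* Main.v *)
Require Import Defs.
From mathcomp Require Import all_boot all_algebra.
From mathcomp Require Import boolp classical_sets.

Set Implicit Arguments.
Unset Strict Implicit.
Unset Printing Implicit Defensive.

Import GRing.Theory.
Local Open Scope ring_scope.
Local Open Scope cat_scope.

(** Let [0 -> R1 -> R0 -> A] be a resolution of length one. Then [A] is the cone
    of [R1 -> R0]: for a homological functor [K] with kernel [I], the sequence
    [K R1 -> K R0 -> K A] is short exact, so the comparison from the cone of
    [R1 -> R0] to [A] is a [K]-isomorphism and its own cone [N] is contractible.
    Maps to contractible objects vanish on projectives, and on [A] by
    hypothesis, so [N = 0] ([length_one_triangle]). A (co)homological functor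
    applied to the resulting triangle [R1 -> R0 -> A -> susp R1] gives a long
    exact sequence, and its piece around [A] splits into a short exact sequence
    whose outer terms are a cokernel and a kernel: these are the derived
    functors in degrees 0 and 1 ([five_term_short_exact]).

    The outer terms have to be computed from arbitrary resolutions, so the maps
    are constructed for these. The map between [F A] and the degree 0 part is
    induced by the augmentation. The map between [F A] and the degree 1 part is
    induced by a map [d : A -> Q 1], where [Q] is a resolution of [susp A]: the
    boundary map [A -> susp R1] followed by a chain map from the suspension of
    [R] to [Q]. By the comparison theorem such maps [d] are natural in [A] up to
    maps that factor through [Q 2 -> Q 1] ([connecting_natural]), which
    disappear in (co)homology. Exactness for arbitrary resolutions follows from
    the length one case by naturality, since comparison maps between
    resolutions of the same object induce mutually inverse maps on derived
    functors.

    For [Ext] one takes an arbitrary resolution [Q] of [susp A]; for [F] and its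
    translates one takes for [Q] the suspension of the given resolution [P] of
    [A]. As the suspension is an automorphism, [shiftF F (n - 1)] equals the
    composite of [shiftF F n] with the suspension, so that the degree 1 derived
    functor of [shiftF F (n - 1)] on [P] is that of [shiftF F n] on [Q]. *)

Local Notation compA := Defs.compA.

(** * Additive categories and functors *)

Section Additive.
Variable T : addcat.

Lemma comp0m (A B D : T) (f : mor A B) : (0 : mor B D) \oc f = 0.
Proof. by apply: (addrI (0 \oc f)); rewrite -compmDl !addr0. Qed.

Lemma compm0 (A B D : T) (g : mor B D) : g \oc (0 : mor A B) = 0.
Proof. by apply: (addrI (g \oc 0)); rewrite -compmDr !addr0. Qed.

Lemma compNm (A B D : T) (g : mor B D) (f : mor A B) : (- g) \oc f = - (g \oc f).
Proof. by apply: (addrI (g \oc f)); rewrite -compmDl !subrr comp0m. Qed.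

Lemma compmN (A B D : T) (g : mor B D) (f : mor A B) : g \oc (- f) = - (g \oc f).
Proof. by apply: (addrI (g \oc f)); rewrite -compmDr !subrr compm0. Qed.

Lemma compmBr (A B D : T) (g : mor B D) (f f' : mor A B) :
  g \oc (f - f') = g \oc f - g \oc f'.
Proof. by rewrite compmDr compmN. Qed.

Lemma zobj_src (A B : T) (f : mor A B) : is_zobj A -> f = 0.
Proof. by move=> A0; rewrite -[f]compm1 A0 compm0. Qed.

Lemma zobj_tgt (A B : T) (f : mor A B) : is_zobj B -> f = 0.
Proof. by move=> B0; rewrite -[f]comp1m B0 comp0m. Qed.

Lemma epi0P (A B : T) (f : mor A B) :
  (forall X (k : mor B X), k \oc f = 0 -> k = 0) <-> epi f.
Proof.
split=> [f0 X x y xy|fe X k kf].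
  by apply/eqP; rewrite -subr_eq0; apply/eqP/f0; rewrite compmBl xy subrr.
by apply: fe; rewrite kf comp0m.
Qed.

Lemma mono0P (A B : T) (f : mor A B) :
  (forall X (h : mor X A), f \oc h = 0 -> h = 0) <-> mono f.
Proof.
split=> [f0 X x y xy|fm X h fh].
  by apply/eqP; rewrite -subr_eq0; apply/eqP/f0; rewrite compmBr xy subrr.
by apply: fm; rewrite fh compm0.
Qed.

Lemma kernel_mono (A B K : T) (f : mor A B) (k : mor K A) :
  is_kernel f k -> mono k.
Proof.
move=> [fk kU]; apply/mono0P=> X h kh.
have [|x [_ xU]] := kU _ (k \oc h); first by rewrite compA fk comp0m.
by rewrite -(xU h) // (xU 0) // kh compm0.
Qed.

End Additive.

Lemma cokernel_epi (T : addcat) (A B Q : T) (f : mor A B) (q : mor B Q) :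
  is_cokernel f q -> epi q.
Proof. exact: (@kernel_mono (op T) B A Q f q). Qed.

Section Functors.
Variables (T U : addcat).
Implicit Type F : functor T U.

Lemma fmor0 F (A B : T) : fmor F (0 : mor A B) = 0.
Proof. by apply: (addrI (fmor F 0)); rewrite -fmorD !addr0. Qed.

Lemma fmorN F (A B : T) (f : mor A B) : fmor F (- f) = - fmor F f.
Proof. by apply: (addrI (fmor F f)); rewrite -fmorD !subrr fmor0. Qed.

Lemma fmorB F (A B : T) (f g : mor A B) : fmor F (f - g) = fmor F f - fmor F g.
Proof. by rewrite fmorD fmorN. Qed.

Lemma fmor_zobj F (A : T) : is_zobj A -> is_zobj (F A).
Proof. by rewrite /is_zobj => A0; rewrite -fmor1 A0 fmor0. Qed.

Lemma eq_functor_iso F G : F = G ->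
  exists (t : forall A, mor (F A) (G A)) (t' : forall A, mor (G A) (F A)),
    [/\ forall A, t' A \oc t A = idm _, forall A, t A \oc t' A = idm _
      & forall A B (f : mor A B), t B \oc fmor F f = fmor G f \oc t A].
Proof.
by move=> <-; exists (fun A => idm _), (fun A => idm _);
  split=> *; rewrite comp1m ?compm1.
Qed.

(** Proof irrelevance makes functors with convertible actions equal; this turns
    associativity of composition, and the comparison of iterates of the
    suspension, into equalities of functors. *)
Lemma functor_eq (o : T -> U) (m : forall A B : T, mor A B -> mor (o A) (o B))
    p1 p2 p3 q1 q2 q3 :
  @Functor T U o m p1 p2 p3 = @Functor T U o m q1 q2 q3.
Proof. by congr Functor; exact: Prop_irrelevance. Qed.

End Functors.

Lemma fcompA (T U V W : addcat) (H : functor V W) (G : functor U V)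
    (F : functor T U) : fcomp H (fcomp G F) = fcomp (fcomp H G) F.
Proof. exact: functor_eq. Qed.

Lemma fcompf1 (T U : addcat) (F : functor T U) : fcomp F (fid T) = F.
Proof. case: F => *; exact: functor_eq. Qed.

Lemma fcomp1f (T U : addcat) (F : functor T U) : fcomp (fid U) F = F.
Proof. case: F => *; exact: functor_eq. Qed.

Section Contravariant.
Variables (T U : addcat) (F : functor (op T) U).

Lemma comorM (A B D : T) (g : mor B D) (f : mor A B) :
  comor F (g \oc f) = comor F f \oc comor F g.
Proof. exact: (@fmorM _ _ F D B A f g). Qed.

Lemma comor1 (A : T) : comor F (idm A) = idm (F A).
Proof. exact: fmor1. Qed.

Lemma comor0 (A B : T) : comor F (0 : mor A B) = 0.
Proof. exact: (@fmor0 _ _ F B A). Qed.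

Lemma comorD (A B : T) (f g : mor A B) : comor F (f + g) = comor F f + comor F g.
Proof. exact: (@fmorD _ _ F B A f g). Qed.

Lemma comorN (A B : T) (f : mor A B) : comor F (- f) = - comor F f.
Proof. exact: (@fmorN _ _ F B A f). Qed.

Lemma comorB (A B : T) (f g : mor A B) : comor F (f - g) = comor F f - comor F g.
Proof. exact: (@fmorB _ _ F B A f g). Qed.

End Contravariant.

(** * Functors with an inverse *)

Section InverseFunctors.
Variables (T : addcat) (S S' : functor T T).
Hypothesis SP : inverse_functors S S'.

Lemma inverse_faithful (A B : T) (f g : mor A B) : fmor S f = fmor S g -> f = g.
Proof.
have [_ /eq_functor_iso[t [t' [t't tt' nat_t]]]] := SP.
move=> fg; have fE h : h = t B \oc fmor S' (fmor S h) \oc t' A.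
  by rewrite (nat_t A B h) -compA tt' compm1.
by rewrite [f]fE fg -fE.
Qed.

End InverseFunctors.

Lemma inverse_functorsC (T : addcat) (S S' : functor T T) :
  inverse_functors S S' -> inverse_functors S' S.
Proof. by case. Qed.

Lemma inverse_full (T : addcat) (S S' : functor T T) (SP : inverse_functors S S')
    (A B : T) (g : mor (S A) (S B)) : exists f, fmor S f = g.
Proof.
have [_ /eq_functor_iso[t [t' [t't tt' nat_t]]]] := SP.
exists (t B \oc fmor S' g \oc t' A).
apply: (inverse_faithful (inverse_functorsC SP)).
set f := _ \oc _ \oc _.
rewrite -[LHS]comp1m -(t't B) -compA (nat_t A B f) /f /= !compA.
by rewrite t't comp1m -compA t't compm1.
Qed.

(** * Exactness in Abelian categories *)

Section Exactness.
Variable C : abelian.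

Lemma kerm_comp (A B : C) (f : mor A B) : f \oc kerm f = 0.
Proof. by case: (kermP f). Qed.
Lemma kerm_mono (A B : C) (f : mor A B) : mono (kerm f).
Proof. exact: kernel_mono (kermP f). Qed.
Lemma cokerm_comp (A B : C) (f : mor A B) : cokerm f \oc f = 0.
Proof. by case: (cokermP f). Qed.
Lemma cokerm_epi (A B : C) (f : mor A B) : epi (cokerm f).
Proof. exact: cokernel_epi (cokermP f). Qed.

(** A self-dual, element-free form of exactness: the second condition says that
    the composite [ker g -> B -> coker f] vanishes. *)
Lemma exactE (A B D : C) (f : mor A B) (g : mor B D) :
  exact_at f g <->
  g \oc f = 0 /\ forall (X Y : C) (h : mor X B) (k : mor B Y),
    g \oc h = 0 -> k \oc f = 0 -> k \oc h = 0.
Proof.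
split=> [[gi iU]|[gf fgP]].
  split=> [|X Y h k gh kf].
    by rewrite -(ker_liftP (cokerm_comp f)) compA gi comp0m.
  have [x [<- _]] := iU _ _ gh.
  by rewrite -(coker_descP kf) -compA [_ \oc (imm f \oc x)]compA kerm_comp
    comp0m compm0.
split=> [|X h gh].
  by rewrite -(coker_descP gf) -compA kerm_comp compm0.
have ch := fgP _ _ _ _ gh (cokerm_comp f).
exists (ker_lift (cokerm f) h); split; first exact: ker_liftP.
by move=> y yh; apply: (@kerm_mono _ _ (cokerm f)); rewrite ker_liftP.
Qed.

Lemma exact_comp0 (A B D : C) (f : mor A B) (g : mor B D) :
  exact_at f g -> g \oc f = 0.
Proof. by case/exactE. Qed.

Lemma exact_atNr (A B D : C) (f : mor A B) (g : mor B D) :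
  exact_at f (- g) -> exact_at f g.
Proof.
move=> /exactE[gf fgP]; apply/exactE; split.
  by apply: oppr_inj; rewrite -compNm gf oppr0.
by move=> X Y h k gh; apply: fgP; rewrite compNm gh oppr0.
Qed.

Lemma exact_atNl (A B D : C) (f : mor A B) (g : mor B D) :
  exact_at (- f) g -> exact_at f g.
Proof.
move=> /exactE[gf fgP]; apply/exactE; split.
  by apply: oppr_inj; rewrite -compmN gf oppr0.
by move=> X Y h k gh kf; apply: fgP => //; rewrite compmN kf oppr0.
Qed.

Lemma exact_mono (A B D : C) (f : mor A B) (g : mor B D) :
  exact_at f g -> f = 0 -> mono g.
Proof.
move=> /exactE[_ fgP] f0; apply/mono0P => X h gh.
by rewrite -[h]comp1m; apply: fgP; rewrite // f0 compm0.
Qed.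

Lemma short_exactE (A B D : C) (i : mor A B) (p : mor B D) :
  short_exact i p <-> [/\ mono i, exact_at i p & epi p].
Proof.
split=> [[iP ip pP]|[iP ip pP]].
  split=> //; first exact: exact_mono iP erefl.
  apply/epi0P => X k kp; have /exactE[_ pP'] := pP.
  by rewrite -[k]compm1; apply: pP'; rewrite // comp0m.
split=> //; apply/exactE; split; rewrite ?compm0 ?comp0m // => X Y h k.
  by move/mono0P: iP => iP /iP -> _; rewrite compm0.
by move/epi0P: pP => pP _ /pP ->; rewrite comp0m.
Qed.

(** Suppose [i] kills [h], and let [c] be the cokernel of [h]. The epimorphism
    [c \oc q] is the cokernel of some [m]. Since [g] factors through [c \oc q],
    it kills [m]; by exactness so does [q]. Hence [q] factors through [c \oc q],
    so [c] is a split monomorphism, and [h = 0]. *)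
Lemma exact_factor_mono (A B D Q : C) (f : mor A B) (g : mor B D)
    (q : mor B Q) (i : mor Q D) :
  exact_at f g -> epi q -> q \oc f = 0 -> i \oc q = g -> mono i.
Proof.
move=> /exactE[_ fgP] qe qf iq; apply/mono0P => X h ih.
have ce : epi (cokerm h \oc q).
  by move=> Y x y; rewrite !compA => /qe; exact: cokerm_epi.
have [W [m [cqm mU]]] := epi_normal ce.
have qm : q \oc m = 0.
  apply: fgP => //.
  by rewrite -iq -(coker_descP ih) -!compA [_ \oc (q \oc m)]compA cqm compm0.
have [s [sq _]] := mU _ _ qm.
have sc : s \oc cokerm h = idm Q by apply: qe; rewrite -compA sq comp1m.
by rewrite -[h]comp1m -sc -compA cokerm_comp compm0.
Qed.

End Exactness.

(** The dual of the previous lemma is obtained by passing to the opposite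
    category. *)
Definition op_abelian (C : abelian) : abelian :=
  @Abelian (op C) (fun A B f => @has_cokernel C B A f)
    (fun A B f => @has_kernel C B A f)
    (fun A B f => @epi_normal C B A f) (fun A B f => @mono_normal C B A f).

Lemma exact_op (C : abelian) (A B D : C) (f : mor A B) (g : mor B D) :
  exact_at f g -> @exact_at (op_abelian C) D B A g f.
Proof.
move=> /exactE[gf fgP]; apply/exactE; split=> // X Y h k hf gk.
exact: (fgP Y X k h).
Qed.

Lemma exact_factor_epi (C : abelian) (A B D K : C) (f : mor A B) (g : mor B D)
    (m : mor K B) (e : mor A K) :
  exact_at f g -> mono m -> g \oc m = 0 -> m \oc e = f -> epi e.
Proof. by move=> /exact_op/(@exact_factor_mono (op_abelian C) _ _ _ K); apply. Qed.

(** * Homology of three-term complexes *)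

Section Homology.
Variable C : abelian.

Definition homology_class (A B D : C) (f : mor A B) (g : mor B D) :
    mor (ker g) (homology f g) := cokerm (ker_lift g f).

Lemma homology_class_epi (A B D : C) (f : mor A B) (g : mor B D) : epi (homology_class f g).
Proof. exact: cokerm_epi. Qed.

Definition from_homology (A B D Y : C) (f : mor A B) (g : mor B D) (v : mor B Y) :
    mor (homology f g) Y := coker_desc (ker_lift g f) (v \oc kerm g).

Definition to_homology (A B D Y : C) (f : mor A B) (g : mor B D) (w : mor Y B) :
    mor Y (homology f g) := homology_class f g \oc ker_lift g w.

Lemma from_homologyE (A B D Y : C) (f : mor A B) (g : mor B D) (v : mor B Y) :
  g \oc f = 0 -> v \oc f = 0 -> from_homology f g v \oc homology_class f g = v \oc kerm g.
Proof. by move=> gf vf; apply: coker_descP; rewrite -compA ker_liftP. Qed.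

Lemma homology_class_eq (A B D X : C) (f : mor A B) (g : mor B D) (x y : mor X (ker g))
    (h : mor X A) : g \oc f = 0 -> kerm g \oc x = kerm g \oc y + f \oc h ->
  homology_class f g \oc x = homology_class f g \oc y.
Proof.
move=> gf xy; have -> : x = y + ker_lift g f \oc h.
  by apply: (@kerm_mono _ _ _ g); rewrite xy compmDr compA ker_liftP.
by rewrite compmDr compA cokerm_comp comp0m addr0.
Qed.

Section Maps.
Variables (A B D A' B' D' : C).
Variables (f : mor A B) (g : mor B D) (f' : mor A' B') (g' : mor B' D').

Definition compatible (t : mor B B') :=
  (exists a : mor A A', t \oc f = f' \oc a) /\
  (exists c : mor D D', g' \oc t = c \oc g).

Hypotheses (gf : g \oc f = 0) (gf' : g' \oc f' = 0).

Lemma compatible_cycle t : compatible t -> g' \oc (t \oc kerm g) = 0.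
Proof. by case=> _ [c gt]; rewrite compA gt -compA kerm_comp compm0. Qed.

Lemma homology_mapE t : compatible t ->
  homology_map f g f' g' t \oc homology_class f g
    = homology_class f' g' \oc ker_lift g' (t \oc kerm g).
Proof.
move=> tP; apply: coker_descP; have [[a ta] _] := tP.
rewrite -compA -[RHS](compm0 _ (homology_class f' g')).
apply: (@homology_class_eq _ _ _ _ _ _ _ _ a) => //.
by rewrite compA ker_liftP ?compatible_cycle // -compA ker_liftP // compm0 add0r.
Qed.

Lemma homology_map_homotopic t t' (h : mor B A') (k : mor D B') :
  compatible t -> compatible t' -> t - t' = f' \oc h + k \oc g ->
  homology_map f g f' g' t = homology_map f g f' g' t'.
Proof.
move=> tP tP' tt'; apply: (@homology_class_epi _ _ _ f g); rewrite !homology_mapE //.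
apply: (@homology_class_eq _ _ _ _ _ _ _ _ (h \oc kerm g)) => //.
rewrite !ker_liftP ?compatible_cycle //; apply/eqP.
rewrite addrC -subr_eq -compmBl tt' compmDl -!compA kerm_comp compm0 addr0.
by [].
Qed.

Lemma from_homology_natural (Y Y' : C) (v : mor B Y) (v' : mor B' Y') t
    (y : mor Y Y') (k : mor D Y') :
  compatible t -> v \oc f = 0 -> v' \oc f' = 0 ->
  v' \oc t = y \oc v + k \oc g ->
  from_homology f' g' v' \oc homology_map f g f' g' t
    = y \oc from_homology f g v.
Proof.
move=> tP vf vf' vt; apply: (@homology_class_epi _ _ _ f g).
rewrite -compA homology_mapE // compA from_homologyE // -!compA.
rewrite ker_liftP ?compatible_cycle // from_homologyE // !compA vt.
by rewrite compmDl -(compA k) kerm_comp compm0 addr0.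
Qed.

Lemma to_homology_natural (Y Y' : C) (w : mor Y B) (w' : mor Y' B') t
    (y : mor Y Y') (h : mor Y A') :
  compatible t -> g \oc w = 0 -> g' \oc w' = 0 ->
  t \oc w = w' \oc y + f' \oc h ->
  homology_map f g f' g' t \oc to_homology f g w
    = to_homology f' g' w' \oc y.
Proof.
move=> tP gw gw' tw; rewrite compA homology_mapE // -!compA.
apply: (@homology_class_eq _ _ _ _ _ _ _ _ h) => //.
rewrite !compA !ker_liftP ?compatible_cycle // -tw.
by rewrite -compA ker_liftP.
Qed.

End Maps.

Lemma homology_map1 (A B D : C) (f : mor A B) (g : mor B D) :
  g \oc f = 0 -> homology_map f g f g (idm B) = idm (homology f g).
Proof.
move=> gf; apply: (@homology_class_epi _ _ _ f g); rewrite homology_mapE //.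
  rewrite !comp1m -[RHS]compm1; apply: (homology_class_eq (h := 0) gf).
  by rewrite ker_liftP ?kerm_comp // compm1 compm0 addr0.
by split; [exists (idm A)|exists (idm D)]; rewrite compm1 comp1m.
Qed.

Lemma homology_mapM (A B D A' B' D' A2 B2 D2 : C)
    (f : mor A B) (g : mor B D) (f' : mor A' B') (g' : mor B' D')
    (f2 : mor A2 B2) (g2 : mor B2 D2) (t' : mor B' B2) (t : mor B B') :
  g \oc f = 0 -> g' \oc f' = 0 -> g2 \oc f2 = 0 ->
  compatible f g f' g' t -> compatible f' g' f2 g2 t' ->
  homology_map f' g' f2 g2 t' \oc homology_map f g f' g' t
    = homology_map f g f2 g2 (t' \oc t).
Proof.
move=> gf gf' gf2 tP tP'; have tP2 : compatible f g f2 g2 (t' \oc t).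
  have [[[a ta] [c tc]] [[a' ta'] [c' tc']]] := (tP, tP').
  split; [exists (a' \oc a)|exists (c' \oc c)].
    by rewrite -compA ta compA ta' compA.
  by rewrite compA tc' -compA tc compA.
apply: (@homology_class_epi _ _ _ f g); rewrite -compA !homology_mapE //.
rewrite compA homology_mapE // -compA.
apply: (@homology_class_eq _ _ _ _ _ _ _ _ 0 gf2).
rewrite compm0 addr0 compA !ker_liftP ?(compatible_cycle tP2) //.
  by rewrite -compA ker_liftP ?(compatible_cycle tP) // compA.
exact: compatible_cycle tP'.
Qed.

(** A five-term exact sequence [u, v, w, x] breaks into a short exact sequence
    from [coker u] to [ker x]; these are homology objects of complexes in which
    one of the two maps is zero. *)
Lemma five_term_short_exact (X1 X0 X' Y Z' Z1 Z0 : C) (u : mor X1 X0)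
    (g : mor X0 X') (v : mor X0 Y) (w : mor Y Z1) (f : mor Z' Z1) (x : mor Z1 Z0) :
  exact_at u v -> exact_at v w -> exact_at w x -> g = 0 -> f = 0 ->
  short_exact (from_homology u g v) (to_homology f x w).
Proof.
move=> uv vw wx g0 f0.
have gu : g \oc u = 0 by rewrite g0 comp0m.
have kj : kerm g \oc ker_lift g (idm X0) = idm X0.
  by apply: ker_liftP; rewrite g0 comp0m.
have jk : ker_lift g (idm X0) \oc kerm g = idm (ker g).
  by apply: (@kerm_mono _ _ _ g); rewrite compA kj comp1m compm1.
have iE := from_homologyE gu (exact_comp0 uv).
(* As [f = 0], taking classes of cycles of [x] is injective. *)
have pi_mono : mono (homology_class f x).
  apply/mono0P => X h ph.
  have id0 : idm (ker x) \oc ker_lift x f = 0.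
    apply: (@kerm_mono _ _ _ x); rewrite comp1m ker_liftP f0 ?compm0 //.
  by rewrite -[h]comp1m -(coker_descP id0) -compA -/(homology_class f x) ph compm0.
apply/short_exactE; split.
- (* As [g = 0], the inclusion of the cycles is invertible, and composing the
     class map with its inverse gives the cokernel of [u]. *)
  apply: (@exact_factor_mono _ _ _ _ _ u v (homology_class u g \oc ker_lift g (idm X0)) _ uv).
  + move=> X a b; rewrite !compA => ab; apply: (@homology_class_epi _ _ _ u g).
    by rewrite -[LHS]compm1 -[RHS]compm1 -jk !compA ab.
  + rewrite -compA -(compm0 _ (homology_class u g)).
    apply: (@homology_class_eq _ _ _ _ _ _ _ _ (idm X1)) => //.
    by rewrite compA kj compm0 add0r compm1 comp1m.
  + by rewrite compA iE -compA kj compm1.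
- have [wv vwP] := (exactE _ _).1 vw; apply/exactE; split=> [|X W h k ph ki].
    apply: (@homology_class_epi _ _ _ u g); rewrite comp0m -compA iE compA.
    have -> : to_homology f x w \oc v = 0; last by rewrite comp0m.
    rewrite -compA; have -> : ker_lift x w \oc v = 0; last by rewrite compm0.
    apply: (@kerm_mono _ _ _ x).
    by rewrite compA ker_liftP ?wv ?compm0 ?(exact_comp0 wx).
  apply: vwP.
    rewrite -(ker_liftP (exact_comp0 wx)) -compA.
    have /mono0P pi0 := pi_mono.
    by rewrite [_ \oc h]pi0 ?compm0 // compA.
  by rewrite -[v]compm1 -kj [v \oc _]compA -iE !compA ki !comp0m.
have le : epi (ker_lift x w).
  apply: (exact_factor_epi wx (@kerm_mono _ _ _ x)); first exact: kerm_comp.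
  exact: ker_liftP (exact_comp0 wx).
by move=> X a b; rewrite !compA => /le; exact: homology_class_epi.
Qed.

Lemma short_exact_isom (A A' B D D' : C) (i : mor A B) (i' : mor A' B)
    (p : mor B D) (p' : mor B D') (a : mor A A') (a' : mor A' A) (b : mor D D')
    (b' : mor D' D) :
  a \oc a' = idm A' -> a' \oc a = idm A -> b \oc b' = idm D' ->
  b' \oc b = idm D -> i' \oc a = i -> b \oc p = p' ->
  short_exact i p -> short_exact i' p'.
Proof.
move=> aa' a'a bb' b'b ia bp /short_exactE[im /exactE[pi ipP] pe].
have i'E : i' = i \oc a' by rewrite -ia -compA aa' compm1.
apply/short_exactE; split.
- rewrite i'E => X x y; rewrite -!compA => /im xy.
  by rewrite -[x]comp1m -aa' -compA xy compA aa' comp1m.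
- apply/exactE; split=> [|X Y h k p'h ki'].
    by rewrite -bp i'E -compA (compA p) pi comp0m compm0.
  apply: ipP; last by rewrite -ia compA ki' comp0m.
  by rewrite -[p]comp1m -b'b -(compA b') bp -compA p'h compm0.
rewrite -bp => X x y; rewrite !compA => /pe xy.
by rewrite -[x]compm1 -bb' compA xy -compA bb' compm1.
Qed.

End Homology.

(** * Triangulated categories *)

Section Triangles.
Variable T : triangulated.

Lemma susp_faithful (A B : T) (f g : mor A B) :
  fmor susp f = fmor susp g -> f = g.
Proof. exact: inverse_faithful (suspP T) _ _ _ _. Qed.

Lemma susp_full (A B : T) (g : mor (susp A) (susp B)) :
  exists f : mor A B, fmor susp f = g.
Proof. exact: inverse_full (suspP T) _ _ _. Qed.

Lemma susp_eq0 (A B : T) (f : mor A B) : fmor susp f = 0 -> f = 0.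
Proof. by move=> f0; apply: susp_faithful; rewrite f0 fmor0. Qed.

Lemma isom1 (A : T) : isom (idm A).
Proof. by exists (idm A); rewrite comp1m. Qed.

Lemma isomN (A B : T) (f : mor A B) : isom f -> isom (- f).
Proof. by case=> g [gf fg]; exists (- g); rewrite !compmN !compNm !opprK. Qed.

Section OneTriangle.
Variables (A B D : T) (u : mor A B) (v : mor B D) (w : mor D (susp A)).
Hypothesis tri : exact_tri u v w.

Lemma tri_comp0 : v \oc u = 0.
Proof.
have [|c [-> _]] := tri_mor (tri_id A) tri (a := idm A) (b := u).
  by rewrite compm1.
by rewrite compm0.
Qed.

(** [T(X, -)] is exact on triangles: [x] and the zero map form a morphism from
    a rotation of the identity triangle of [X] to a rotation of the given one;
    its third component is the suspension of the wanted map, up to sign. *)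
Lemma tri_lift (X : T) (x : mor X B) : v \oc x = 0 -> exists y, x = u \oc y.
Proof.
move=> vx; have idtri := (tri_rot _ _ _).1 (tri_id X).
have [|c [_ cE]] := tri_mor idtri ((tri_rot _ _ _).1 tri) (a := x) (b := 0).
  by rewrite vx compm0.
have [y yE] := susp_full c; exists y; apply: susp_faithful.
apply: oppr_inj; rewrite fmorM yE -compNm cE.
by rewrite fmor1 compmN compm1.
Qed.

(** Dually, with a rotation of the identity triangle as the target. *)
Lemma tri_extend (X : T) (x : mor B X) : x \oc u = 0 -> exists y, x = y \oc v.
Proof.
move=> xu; have rot3 := (tri_rot _ _ _).1 ((tri_rot _ _ _).1 ((tri_rot _ _ _).1 tri)).
have idtri := (tri_rot _ _ _).1 ((tri_rot _ _ _).1 (tri_id X)).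
have [|c [cE _]] := tri_mor rot3 idtri (a := 0) (b := fmor susp x).
  by rewrite comp0m compmN -fmorM xu fmor0 oppr0.
have [y yE] := susp_full c; exists y; apply: susp_faithful.
apply: oppr_inj; rewrite fmorM yE -compmN -cE.
by rewrite fmor1 compNm comp1m.
Qed.

(** Rotating three times suspends a triangle and changes three signs, two of
    which are removed by the automorphism [-1] of two of the vertices. *)
Lemma tri_susp : exact_tri (fmor susp u) (fmor susp v) (- fmor susp w).
Proof.
have rot3 := (tri_rot _ _ _).1 ((tri_rot _ _ _).1 ((tri_rot _ _ _).1 tri)).
apply: (tri_iso (a := - idm _) (b := idm _) (c := - idm _) _ _ _ _ _ _ rot3).
- exact/isomN/isom1.
- exact: isom1.
- exact/isomN/isom1.
- by rewrite comp1m compmN compm1.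
- by rewrite compNm compmN opprK comp1m compm1.
- by rewrite fmorN fmor1 compmN compm1 compNm comp1m.
Qed.

End OneTriangle.

Lemma tri_comp0r (A B D : T) (u : mor A B) (v : mor B D) (w : mor D (susp A)) :
  exact_tri u v w -> w \oc v = 0.
Proof. by move/tri_rot/tri_comp0. Qed.

Lemma tri_comp0s (A B D : T) (u : mor A B) (v : mor B D) (w : mor D (susp A)) :
  exact_tri u v w -> fmor susp u \oc w = 0.
Proof.
move/tri_rot/tri_comp0r => uw.
by apply: oppr_inj; rewrite -compNm uw oppr0.
Qed.

(** Functors that send exact triangles to exact triangles, up to the choice of
    the third map; (co)homological functors may be composed with them. *)
Definition preserves_triangles (H : functor T T) : Prop :=
  forall (A B D : T) (u : mor A B) (v : mor B D) (w : mor D (susp A)),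
    exact_tri u v w -> exists w', exact_tri (fmor H u) (fmor H v) w'.

Lemma susp_triangles : preserves_triangles susp.
Proof. by move=> A B D u v w /tri_susp; exists (- fmor susp w). Qed.

(** By [tri_rot] a triangle is exact as soon as its suspension is, up to the
    sign of the third map, and the suspension of the desuspended triangle is
    the given one. *)
Lemma desusp_triangles : preserves_triangles desusp.
Proof.
move=> A B D u v w tri.
have [/eq_functor_iso[t [t' [t't tt' nat_t]]] _] := suspP T.
have nat_t' X Y (f : mor X Y) : t' Y \oc f = fmor susp (fmor desusp f) \oc t' X.
  rewrite -[f in LHS]compm1 -(tt' X) /= [f \oc _]compA -(nat_t X Y f).
  by rewrite !compA t't comp1m.
have [w' w'E] := susp_full (- (fmor susp (t' A) \oc w \oc t D)).
(* Three rotations turn the goal into exactness of the suspended triangle. *)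
exists w'; apply/tri_rot/tri_rot/tri_rot.
apply: (tri_iso (a := - t' A) (b := t' B) (c := - t' D) _ _ _ _ _ _ tri).
- by apply: isomN; exists (t A); split.
- by exists (t B); split.
- by apply: isomN; exists (t D); split.
- by rewrite compNm compmN opprK nat_t'.
- by rewrite compNm nat_t' compNm.
- by rewrite w'E compNm compmN !opprK compNm fmorN compNm -compA tt' compm1.
Qed.

Lemma preserves_comp (G H : functor T T) :
  preserves_triangles G -> preserves_triangles H -> preserves_triangles (fcomp G H).
Proof. by move=> GP HP A B D u v w /HP[w' /GP]. Qed.

Lemma fid_triangles : preserves_triangles (fid T).
Proof. by move=> A B D u v w tri; exists w. Qed.

Lemma spow_triangles n : preserves_triangles (spow T n).
Proof.
case: n => n /=; elim: n => [|n IHn] /=.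
- exact: fid_triangles.
- exact: preserves_comp susp_triangles IHn.
- exact: preserves_comp desusp_triangles fid_triangles.
- exact: preserves_comp desusp_triangles IHn.
Qed.

Lemma spowS n : spow T (n + 1) = fcomp (spow T n) susp.
Proof.
rewrite -zsuccE; case: n => m.
  elim: m => [|m IHm]; first by rewrite /= fcompf1 fcomp1f.
  exact: etrans (congr1 (fcomp susp) IHm) (fcompA _ _ _).
have SS : fcomp desusp susp = fid T by case: (suspP T).
elim: m => [|m IHm]; first by rewrite /= fcompf1 SS.
rewrite -[spow T (Negz m.+1)]/(fcomp desusp (spow T (Negz m))) -fcompA -IHm.
by case: m {IHm} => [|m] //=.
Qed.

Section Shift.
Variable C : abelian.

Lemma shift_homological (F : functor T C) n :
  homological F -> homological (shiftF F n).
Proof. by move=> FP X Y Z u v w /(spow_triangles (- n))[w' /FP]. Qed.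

Lemma coshift_cohomological (F : functor (op T) C) n :
  cohomological F -> cohomological (coshiftF F n).
Proof. by move=> FP X Y Z u v w /(spow_triangles (- n))[w' /FP]. Qed.

(** An equality of functors, not just an isomorphism, allows for identifying
    the derived functors of the two sides. *)
Lemma shiftF_pred (F : functor T C) n :
  shiftF F (n - 1) = fcomp (shiftF F n) susp.
Proof. by rewrite /shiftF opprB addrC spowS fcompA. Qed.

Lemma coshiftF_pred (F : functor (op T) C) n :
  coshiftF F (n - 1) = fcomp (coshiftF F n) (fop susp).
Proof. by rewrite /coshiftF opprB addrC spowS; exact: functor_eq. Qed.

End Shift.

End Triangles.

Lemma homF_cohomological (T : triangulated) (B : T) : cohomological (homF B).
Proof.
move=> X Y Z u v w tri; apply/exactE; split.
  by apply: addhomP => x /=; rewrite -compA (tri_comp0 tri) compm0.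
move=> V W h k uh kv; apply: addhomP => x.
have ux : (h : addhom V _) x \oc u = 0.
  exact: (congr1 (fun f : addhom V (mor X B) => f x) uh).
have [y yE] := tri_extend tri ux.
rewrite [LHS]/= yE.
exact: (congr1 (fun f : addhom (mor Z B) W => f y) kv).
Qed.

(** * Homological ideals and projective resolutions *)

Arguments res_proj [T I A] r n [B C f] _ _.
Arguments res_exact [T I A] r n [X Y f g f' g'] _ _.

Section HomologicalIdeal.
Variables (T : triangulated) (I : ideal T).

Lemma idealMl (A B D : T) (h : mor B D) (f : mor A B) :
  in_ideal I f -> in_ideal I (h \oc f).
Proof. by move=> fI; rewrite -[h \oc f]compm1; exact: idealM. Qed.

Lemma idealMr (A B D : T) (f : mor B D) (g : mor A B) :
  in_ideal I f -> in_ideal I (f \oc g).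
Proof. by move=> fI; rewrite -[f \oc g]comp1m compA; exact: idealM. Qed.

Lemma idealN (A B : T) (f : mor A B) : in_ideal I f -> in_ideal I (- f).
Proof. by move=> fI; rewrite -[- f]sub0r; apply: idealB => //; exact: ideal0. Qed.

Lemma proj_contractible (P B : T) (f : mor P B) :
  projective I P -> contractible I B -> f = 0.
Proof. by move=> PP BI; rewrite -[f]comp1m; exact: PP. Qed.

(** The condition of [ideal_exact] in a single degree. *)
Definition exact_pair (A B D : T) (u' : mor D A) (u : mor A B) : Prop :=
  forall (X Y : T) (f : mor B X) (g : mor X (susp A))
    (f' : mor A Y) (g' : mor Y (susp D)),
    exact_tri u f g -> exact_tri u' f' g' -> in_ideal I (fmor susp f' \oc g).

Section Resolutions.
Variables (A : T) (P : resolution I A).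

Lemma res_exactS n : exact_pair (pdiff P n.+1) (pdiff P n).
Proof. exact: (res_exact P (Posz n)). Qed.

Lemma res_exact0 : exact_pair (pdiff P 0) (paug P).
Proof. exact: (res_exact P (Negz 0)). Qed.

Lemma res_exact_aug : exact_pair (paug P) (0 : mor A zobj).
Proof. exact: (res_exact P (Negz 1)). Qed.

End Resolutions.

Arguments res_exactS [A] P n [X Y f g f' g'] _ _.
Arguments res_exact0 [A] P [X Y f g f' g'] _ _.
Arguments res_exact_aug [A] P [X Y f g f' g'] _ _.

Hypothesis hI : homological_ideal I.

Lemma ideal_susp (A B : T) (f : mor A B) :
  in_ideal I (fmor susp f) <-> in_ideal I f.
Proof.
have [C [S [S' [K [SP KP [t [tiso nat_t]] IE]]]]] := hI.
rewrite !IE; split=> Kf.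
  apply: (inverse_faithful SP); rewrite fmor0.
  have [t' [_ tt']] := tiso A; have := nat_t _ _ f.
  rewrite /= Kf compm0 => /esym SKf.
  by rewrite -[LHS]compm1 -tt' compA SKf comp0m.
have [t' [tt' _]] := tiso B; have := nat_t _ _ f.
rewrite /= Kf fmor0 comp0m => tKf.
by rewrite -[LHS]comp1m -tt' -compA tKf compm0.
Qed.

Lemma ideal_desusp (A B : T) (f : mor A B) :
  in_ideal I f -> in_ideal I (fmor desusp f).
Proof.
have [/eq_functor_iso[t [t' [t't _ nat_t]]] _] := suspP T.
move=> fI; apply/ideal_susp; have -> : fmor susp (fmor desusp f) = t' B \oc f \oc t A.
  by rewrite -compA -(nat_t _ _ f) compA t't comp1m.
exact: idealM.
Qed.

Lemma projective_susp (P : T) : projective I P -> projective I (susp P).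
Proof.
have [_ /eq_functor_iso[t [t' [t't tt' nat_t]]]] := suspP T.
move=> PP B D f fI g; apply: (inverse_faithful (inverse_functorsC (suspP T))).
rewrite fmor0 fmorM -[LHS]compm1 -(t't P) compA -(compA (fmor desusp f)).
by rewrite (PP _ _ _ (ideal_desusp fI)) comp0m.
Qed.

(** An exact pair is exact after applying [T(Q, -)] for projective [Q]: the
    obstruction to lifting [x] along [u'] is, after suspension, a composite of a
    map from [susp Q] with the map that is assumed to lie in the ideal. *)
Lemma exact_pair_lift (A B D Q : T) (u' : mor D A) (u : mor A B) (x : mor Q A) :
  exact_pair u' u -> projective I Q -> u \oc x = 0 -> exists y, x = u' \oc y.
Proof.
move=> uu' QP ux; have [[X [f [g tri]]] [Y [f' [g' tri']]]] := (tri_cone u, tri_cone u').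
apply: (tri_lift tri'); apply: susp_eq0; rewrite fmorM.
have [|z ->] := tri_lift ((tri_rot _ _ _).1 ((tri_rot _ _ _).1 tri)) (x := fmor susp x).
  by rewrite compNm -fmorM ux fmor0 oppr0.
by rewrite compA (projective_susp QP (uu' _ _ _ _ _ _ tri tri')).
Qed.

(** The comparison map [z] allows for the target of [u1] not being literally a
    suspension, as at the end of an augmented complex. Cones are only compared by maps
    in one direction, which suffices since [I] is an ideal. *)
Lemma exact_pair_susp (A B B1 D : T) (u' : mor D A) (u : mor A B)
    (u1 : mor (susp A) B1) (z : mor B1 (susp B)) :
  z \oc u1 = fmor susp u -> exact_pair u' u -> exact_pair (fmor susp u') u1.
Proof.
move=> zu1 uu' X Y f g f' g' tri tri'.
have [[X0 [f0 [g0 tri0]]] [Y0 [f0' [g0' tri0']]]] := (tri_cone u, tri_cone u').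
have [c [_ cE]] := tri_mor tri (tri_susp tri0) (etrans (compm1 _) (esym zu1)).
have [c' [cE' _]] := tri_mor (tri_susp tri0') tri' (etrans (compm1 _) (esym (comp1m _))).
rewrite -[f']compm1 cE' fmorM.
have -> : g = - (fmor susp g0 \oc c).
  by rewrite -compNm cE fmor1 comp1m.
rewrite compmN; apply: idealN; rewrite compA -(compA (fmor susp c')) -fmorM.
by apply/idealM/ideal_susp/uu'; eassumption.
Qed.

Section Suspension.
Variables (A : T) (P : resolution I A).

Lemma susp_pdiffK n :
  fmor susp (pdiff P n) \oc fmor susp (pdiff P n.+1) = 0.
Proof. by rewrite -fmorM pdiffK fmor0. Qed.

Lemma susp_paugK : fmor susp (paug P) \oc fmor susp (pdiff P 0) = 0.
Proof. by rewrite -fmorM paugK fmor0. Qed.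

Definition susp_aug : augmented (susp A) := Augmented susp_pdiffK susp_paugK.

Lemma susp_aug_exact : ideal_exact I (aug_complex susp_aug).
Proof.
case=> [n|[|[|n]]] X Y f g f' g'.
- have E := exact_pair_susp (comp1m _) (res_exactS P n); exact: E.
- have E := exact_pair_susp (comp1m _) (res_exact0 P); exact: E.
- have zE : (0 : mor zobj (susp zobj)) \oc (0 : mor (susp A) zobj)
      = fmor susp (0 : mor A zobj) by rewrite comp0m fmor0.
  have E := exact_pair_susp zE (res_exact_aug P); exact: E.
move=> _ _; have -> : g = 0; last by rewrite compm0; exact: ideal0.
by apply: zobj_tgt; apply: fmor_zobj; exact: zobjP.
Qed.

Definition susp_res : resolution I (susp A) :=
  @Resolution T I (susp A) susp_aug (fun n => projective_susp (res_proj P n))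
    susp_aug_exact.

End Suspension.

(** [A] is the cone of [R1 -> R0]. Let [a] be the comparison map to [A] from a
    cone [Ah], and [N] the cone of [a]. The octahedral axiom makes [N]
    the cone of a map from [susp R1] to the cone of [R0 -> A], and
    ideal-exactness of the resolution puts enough maps of the resulting
    triangles into the ideal to make [N] contractible. Then [A -> N] vanishes
    by hypothesis, and so does every map [susp Ah -> N], as [susp Ah] is an
    extension of suspended projectives; hence the identity of [N] is zero. *)
Lemma length_one_triangle (A : T) (R : resolution I A) :
  length_one R -> (forall B, contractible I B -> forall f : mor A B, f = 0) ->
  exists d : mor A (susp (pobj R 0%N.+1)),
    exact_tri (pdiff R 0) (paug R) d /\ in_ideal I d.
Proof.
move=> R1 A0; have [Ah [v [w tri]]] := tri_cone (pdiff R 0).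
have wI : in_ideal I w.
  have [Y [f' [g' tri']]] := tri_cone (pdiff R 1).
  (* As [R2 = 0], the map [f'] from [R1] to the cone of [R2 -> R1] splits. *)
  have [|s sf'] := tri_extend tri' (x := idm _).
    by rewrite comp1m; apply: zobj_src; exact: R1.
  rewrite -[w]comp1m -fmor1 sf' fmorM -compA; apply: idealMl.
  exact: (res_exactS R 0 tri tri').
have [a aE] := tri_extend tri (paugK R).
have [X [f [g triE]]] := tri_cone (paug R).
have vgI : in_ideal I (fmor susp v \oc g) by exact: (res_exact0 R triE tri).
have fI : in_ideal I f.
  apply/ideal_susp; rewrite -[fmor susp f]compm1 -fmor1 -[fmor susp (idm A)]opprK.
  rewrite compmN; apply: idealN.
  exact: (res_exact_aug R ((tri_rot _ _ _).1 (tri_id A)) triE).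
have [N [b [c triA]]] := tri_cone a.
rewrite aE in triE.
have [al [be [tri3 _ _ bf cb]]] :=
  tri_octa ((tri_rot _ _ _).1 tri) triA triE.
have NI : contractible I N.
  have [C [S [S' [K [SP KP _ IE]]]]] := hI.
  (* Exactness at [K X2]: if [u] is in the ideal, then [K u = 0], so the kernel
     of [K u1] is zero. *)
  have Kmono (X1 X2 X3 : T) (u : mor X1 X2) (u1 : mor X2 X3) u2 :
      exact_tri u u1 u2 -> in_ideal I u -> mono (fmor K u1).
    by move=> /KP/exact_mono uE uI; apply: uE; apply/IE.
  have beI : in_ideal I be.
    have cm : mono (fmor K c).
      by apply: Kmono ((tri_rot _ _ _).1 triA) _; rewrite -bf; exact: idealMl.
    by apply/IE; apply: cm; rewrite compm0 -fmorM cb; apply/IE.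
  (* The map below is monic under [K]; it is also in the ideal, because [w] is,
     so [K N = 0]. *)
  have wcm := Kmono _ _ _ _ _ _ ((tri_rot _ _ _).1 tri3) beI.
  apply/IE; apply: wcm; rewrite compm0 -fmorM compm1.
  by apply/IE; apply: idealMr; apply/ideal_susp.
have b0 := A0 _ NI b.
have N0 : is_zobj N.
  have [|k kc] := tri_extend ((tri_rot _ _ _).1 triA) (x := idm N).
    by rewrite comp1m.
  have [|k' k'E] := tri_extend ((tri_rot _ _ _).1 (tri_susp tri)) (x := k).
    exact: proj_contractible (projective_susp (res_proj R 0)) NI.
  have k'0 : k' = 0.
    exact: proj_contractible (projective_susp (projective_susp (res_proj R 1))) NI.
  by rewrite /is_zobj kc k'E k'0 !comp0m.
have [|s as1] := tri_lift triA (x := idm A); first by rewrite b0 comp0m.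
have sa1 : s \oc a = idm Ah.
  apply/eqP; rewrite -subr_eq0; apply/eqP/susp_eq0.
  have [|y ->] := tri_lift ((tri_rot _ _ _).1 ((tri_rot _ _ _).1 triA))
    (x := fmor susp (s \oc a - idm Ah)).
    by rewrite compNm -fmorM compmBr compA -as1 comp1m compm1 subrr fmor0 oppr0.
  by rewrite (zobj_src c N0) comp0m.
exists (w \oc s); split; last exact: idealMr.
apply: (tri_iso (a := idm _) (b := idm _) (c := a) _ _ _ _ _ _ tri).
- exact: isom1.
- exact: isom1.
- by exists s.
- by rewrite comp1m compm1.
- by rewrite compm1.
- by rewrite -compA sa1 fmor1 comp1m compm1.
Qed.

Section Comparison.
Variables (A A' : T) (f : mor A A') (P : resolution I A) (P' : resolution I A').

Lemma lifts_exist : exists t, lifts f P P' t.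
Proof.
have [|t0 t0E] := exact_pair_lift (res_exact_aug P') (res_proj P 0)
  (x := f \oc paug P); first by rewrite comp0m.
have [|t1 t1E] := exact_pair_lift (res_exact0 P') (res_proj P 1)
  (x := t0 \oc pdiff P 0).
  by rewrite compA -t0E -compA paugK compm0.
(* Two consecutive components of the chain map, as each is lifted from the
   one before it. *)
pose stage n := {p : mor (pobj P n) (pobj P' n) * mor (pobj P n.+1) (pobj P' n.+1)
  | p.1 \oc pdiff P n = pdiff P' n \oc p.2}.
have next n (p : stage n) : {q : stage n.+1 | (sval q).1 = (sval p).2}.
  apply: cid; case: p => -[s0 s1] /= sE.
  have [|s2 s2E] := exact_pair_lift (res_exactS P' n) (res_proj P n.+2)
    (x := s1 \oc pdiff P n.+1).
    by rewrite compA -sE -compA pdiffK compm0.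
  by exists (exist _ (s1, s2) s2E).
pose t := fix t n : stage n :=
  if n is m.+1 then sval (next m (t m)) else exist _ (t0, t1) t1E.
exists (fun n => (sval (t n)).1); split=> [n|]; last exact/esym.
by have := svalP (t n); rewrite -(svalP (next n (t n))).
Qed.

Variables t t' : forall n, mor (pobj P n) (pobj P' n).
Hypotheses (tP : lifts f P P' t) (tP' : lifts f P P' t').

Lemma lifts_homotopic0 : exists h, t 0 - t' 0 = pdiff P' 0 \oc h.
Proof.
apply: exact_pair_lift (res_exact0 P') (res_proj P 0) _.
by rewrite compmBr tP.2 tP'.2 subrr.
Qed.

Lemma lifts_homotopicS n :
  exists h k, t n.+1 - t' n.+1 = pdiff P' n.+1 \oc h + k \oc pdiff P n.
Proof.
(* Any [k] for which the remaining difference in degree [n] vanishes on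
   boundaries can be completed by lifting the remainder in degree [n.+1]. *)
suff [k kE] : exists k, (t n - t' n - pdiff P' n \oc k) \oc pdiff P n = 0.
  have [|h hE] := exact_pair_lift (res_exactS P' n) (res_proj P n.+1)
    (x := t n.+1 - t' n.+1 - k \oc pdiff P n).
    by rewrite !compmBr -tP.1 -tP'.1 compA -!compmBl.
  by exists h, k; rewrite -hE subrK.
elim: n => [|n [k kE]].
  by have [h ->] := lifts_homotopic0; exists h; rewrite subrr comp0m.
have [|h hE] := exact_pair_lift (res_exactS P' n) (res_proj P n.+1)
  (x := t n.+1 - t' n.+1 - k \oc pdiff P n).
  by rewrite !compmBr -tP.1 -tP'.1 compA -!compmBl.
exists h; rewrite -hE opprB addrCA subrr addr0 -compA pdiffK.
exact: compm0.
Qed.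

End Comparison.

Lemma lifts1 (A : T) (P : resolution I A) : lifts (idm A) P P (fun n => idm _).
Proof. by split=> [n|]; rewrite !comp1m compm1. Qed.

Lemma liftsM (A A' A2 : T) (P : resolution I A) (P' : resolution I A')
    (P2 : resolution I A2) g f t' t :
  lifts g P' P2 t' -> lifts f P P' t ->
  lifts (g \oc f) P P2 (fun n => t' n \oc t n).
Proof.
move=> tP' tP; split=> [n|].
  by rewrite -compA tP.1 compA tP'.1 compA.
by rewrite compA tP'.2 -!compA tP.2.
Qed.

Lemma lifts_susp (A A' : T) (P : resolution I A) (P' : resolution I A') f t :
  lifts f P P' t ->
  lifts (fmor susp f) (susp_res P) (susp_res P') (fun n => fmor susp (t n)).
Proof. by move=> [td te]; split=> [n|] /=; rewrite -!fmorM ?td ?te. Qed.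

(** * Connecting maps *)

(** [d : A -> Q 1] is induced, along a chain map, by the boundary map of the
    triangle of a length one resolution. It is a cycle, unique up to maps that
    factor through [Q 2 -> Q 1], and so determines a map to homology, and dually
    from cohomology, in degree 1. *)
Definition connecting (A : T) (Q : resolution I (susp A)) (d : mor A (pobj Q 1)) :=
  exists (R : resolution I A) (r : forall n, mor (pobj (susp_res R) n) (pobj Q n))
    (dR : mor A (susp (pobj R 0%N.+1))),
    [/\ length_one R, exact_tri (pdiff R 0) (paug R) dR, in_ideal I dR,
        lifts (idm (susp A)) (susp_res R) Q r & d = r 1%N \oc dR].

Arguments connecting [A] Q d.

Lemma connecting_exists (A : T) (Q : resolution I (susp A)) :
  uct_object I A -> exists d, connecting Q d.
Proof.
move=> [[R R1] A0]; have [dR [tri dI]] := length_one_triangle R1 A0.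
have [r rP] := lifts_exist (idm (susp A)) (susp_res R) Q.
by exists (r 1%N \oc dR), R, r, dR.
Qed.

Lemma connecting_refl (A : T) (R : resolution I A) dR :
  length_one R -> exact_tri (pdiff R 0) (paug R) dR -> in_ideal I dR ->
  connecting (susp_res R) dR.
Proof.
move=> R1 tri dI; exists R, (fun k => idm _), dR; split=> //.
  exact: lifts1.
by rewrite comp1m.
Qed.

Lemma connecting_comp0 (A : T) (Q : resolution I (susp A)) d :
  connecting Q d -> pdiff Q 0 \oc d = 0.
Proof.
move=> [R [r [dR [_ tri _ rP ->]]]].
by rewrite compA -rP.1 -compA /= (tri_comp0s tri) compm0.
Qed.

(** A chain map between length one resolutions completes to a morphism of
    triangles, whose third component need not be [f]; the difference factors
    through a map from a projective, which the boundary map kills. *)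
Lemma triangle_natural (A A' : T) (R : resolution I A) (R' : resolution I A')
    dR dR' f t :
  exact_tri (pdiff R 0) (paug R) dR -> exact_tri (pdiff R' 0) (paug R') dR' ->
  in_ideal I dR' -> lifts f R R' t -> fmor susp (t 1%N) \oc dR = dR' \oc f.
Proof.
move=> tri tri' dI [td te].
have [c [ce cd]] := tri_mor tri tri' (esym (td 0%N)).
have [|h hE] := tri_extend ((tri_rot _ _ _).1 tri) (x := f - c).
  by rewrite compmBl -te ce subrr.
rewrite -cd; apply/eqP; rewrite eq_sym -subr_eq0 -compmBr hE compA.
by rewrite (projective_susp (res_proj R 1) dI) comp0m.
Qed.

Lemma connecting_natural (A A' : T) (Q : resolution I (susp A))
    (Q' : resolution I (susp A')) d d' f s :
  connecting Q d -> connecting Q' d' -> lifts (fmor susp f) Q Q' s ->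
  exists h, s 1%N \oc d = d' \oc f + pdiff Q' 1 \oc h.
Proof.
move=> [R [r [dR [_ tri _ rP ->]]]] [R' [r' [dR' [_ tri' dI' rP' ->]]]] sP.
have [t tP] := lifts_exist f R R'.
have srP := liftsM sP rP; have rtP := liftsM rP' (lifts_susp tP).
rewrite compm1 in srP; rewrite comp1m in rtP.
have [h [k hkE]] := lifts_homotopicS srP rtP 0.
have srE : s 1%N \oc r 1%N = r' 1%N \oc fmor susp (t 1%N)
    + (pdiff Q' 1 \oc h + k \oc fmor susp (pdiff R 0)).
  by apply/eqP; rewrite addrC -subr_eq; apply/eqP.
exists (h \oc dR); rewrite -compA -(triangle_natural tri tri' dI' tP).
rewrite compA srE !compmDl -(compA k) (tri_comp0s tri) compm0 addr0.
by rewrite -!compA.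
Qed.

End HomologicalIdeal.

Arguments connecting [T I] hI [A] Q d.

(** * Derived functors *)

Section LeftDerived.
Variables (T : triangulated) (I : ideal T) (hI : homological_ideal I).
Variables (C : abelian) (F : functor T C).

Lemma left_complex (A : T) (P : resolution I A) n :
  dout (fun k => fmor F (pdiff P k)) n \oc fmor F (pdiff P n) = 0.
Proof. by case: n => [|n] /=; rewrite ?comp0m // -fmorM pdiffK fmor0. Qed.

Section Complexes.
Variables (A A' : T) (P : resolution I A) (P' : resolution I A').

Lemma left_compatible f t n : lifts f P P' t ->
  compatible (fmor F (pdiff P n)) (dout (fun k => fmor F (pdiff P k)) n)
    (fmor F (pdiff P' n)) (dout (fun k => fmor F (pdiff P' k)) n) (fmor F (t n)).
Proof.
move=> [td _]; split; first by exists (fmor F (t n.+1)); rewrite -!fmorM td.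
case: n => [|n] /=; first by exists 0; rewrite !comp0m.
by exists (fmor F (t n)); rewrite -!fmorM td.
Qed.

Lemma leftD_map_eq f t t' n : lifts f P P' t -> lifts f P P' t' ->
  leftD_map F n P P' t = leftD_map F n P P' t'.
Proof.
move=> tP tP'; case: n => [|n].
  have [h hE] := lifts_homotopic0 hI tP tP'.
  refine (homology_map_homotopic (h := fmor F h) (k := 0) (left_complex P 0)
    (left_complex P' 0) (left_compatible 0 tP) (left_compatible 0 tP') _).
  by rewrite -fmorB hE fmorM comp0m addr0.
have [h [k hkE]] := lifts_homotopicS hI tP tP' n.
refine (homology_map_homotopic (h := fmor F h) (k := fmor F k) (left_complex P n.+1)
  (left_complex P' n.+1) (left_compatible n.+1 tP) (left_compatible n.+1 tP') _).
by rewrite -fmorB hkE fmorD !fmorM.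
Qed.

End Complexes.

Lemma leftD_map1 (A : T) (P : resolution I A) n :
  leftD_map F n P P (fun k => idm _) = idm (leftD F n P).
Proof.
by rewrite /leftD_map /chain_homology_map fmor1; exact: homology_map1 (left_complex P n).
Qed.

Lemma leftD_mapM (A A' A2 : T) (P : resolution I A) (P' : resolution I A')
    (P2 : resolution I A2) g f t' t n :
  lifts f P P' t -> lifts g P' P2 t' ->
  leftD_map F n P' P2 t' \oc leftD_map F n P P' t
    = leftD_map F n P P2 (fun k => t' k \oc t k).
Proof.
move=> tP tP'; rewrite /leftD_map /chain_homology_map fmorM.
exact: homology_mapM (left_complex P n) (left_complex P' n) (left_complex P2 n)
  (left_compatible n tP) (left_compatible n tP').
Qed.

Lemma leftD_map_inv (A : T) (P P' : resolution I A) t t' n :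
  lifts (idm A) P P' t -> lifts (idm A) P' P t' ->
  leftD_map F n P' P t' \oc leftD_map F n P P' t = idm _.
Proof.
move=> tP tP'; rewrite (leftD_mapM _ tP tP') -leftD_map1.
by apply: leftD_map_eq (lifts1 P); rewrite -[idm A]comp1m; exact: liftsM.
Qed.

Definition left_aug (A : T) (P : resolution I A) : mor (leftD F 0 P) (F A) :=
  from_homology (fmor F (pdiff P 0)) (dout (fun k => fmor F (pdiff P k)) 0)
    (fmor F (paug P)).

Definition left_conn (A : T) (Q : resolution I (susp A)) (d : mor A (pobj Q 1)) :
    mor (F A) (leftD F 1 Q) :=
  to_homology (fmor F (pdiff Q 1)) (dout (fun k => fmor F (pdiff Q k)) 1)
    (fmor F d).

Arguments left_conn [A] Q d.

Lemma left_aug_natural (A A' : T) (P : resolution I A) (P' : resolution I A') f t :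
  lifts f P P' t ->
  left_aug P' \oc leftD_map F 0 P P' t = fmor F f \oc left_aug P.
Proof.
move=> tP; refine (from_homology_natural (k := 0) (left_complex P 0)
  (left_complex P' 0) (left_compatible 0 tP) _ _ _).
- by rewrite -fmorM paugK fmor0.
- by rewrite -fmorM paugK fmor0.
- by rewrite -!fmorM tP.2 comp0m addr0.
Qed.

Lemma left_conn_natural (A A' : T) (Q : resolution I (susp A))
    (Q' : resolution I (susp A')) d d' f s :
  connecting hI Q d -> connecting hI Q' d' -> lifts (fmor susp f) Q Q' s ->
  left_conn Q' d' \oc fmor F f = leftD_map F 1 Q Q' s \oc left_conn Q d.
Proof.
move=> dP dP' sP; have [h hE] := connecting_natural dP dP' sP; apply/esym.
refine (to_homology_natural (h := fmor F h) (left_complex Q 1)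
  (left_complex Q' 1) (left_compatible 1 sP) _ _ _).
- by rewrite -fmorM (connecting_comp0 dP) fmor0.
- by rewrite -fmorM (connecting_comp0 dP') fmor0.
- by rewrite -!fmorM hE fmorD.
Qed.

(** The length one case is transported along comparison maps to [P] and [Q]. *)
Lemma left_short_exact (A : T) (P : resolution I A) (Q : resolution I (susp A)) d :
  homological F -> connecting hI Q d ->
  short_exact (left_aug P) (left_conn Q d).
Proof.
move=> hF dP; have [R [r [dR [R1 tri dI rP _]]]] := dP.
have dRP := connecting_refl hI R1 tri dI.
have [a aP] := lifts_exist hI (idm A) R P.
have [a' aP'] := lifts_exist hI (idm A) P R.
have [r' rP'] := lifts_exist hI (idm (susp A)) Q (susp_res hI R).
have RS : short_exact (left_aug R) (left_conn (susp_res hI R) dR).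
  apply: five_term_short_exact.
  - exact: hF tri.
  - exact: hF ((tri_rot _ _ _).1 tri).
  - apply: exact_atNr; rewrite -fmorN.
    exact: hF ((tri_rot _ _ _).1 ((tri_rot _ _ _).1 tri)).
  - by [].
  - apply: zobj_src; do 2!apply: fmor_zobj; exact: R1.
have [aa' a'a] := (leftD_map_inv 0 aP' aP, leftD_map_inv 0 aP aP').
have [rr' r'r] := (leftD_map_inv 1 rP' rP, leftD_map_inv 1 rP rP').
rewrite -fmor1 in rP rP'.
apply: (short_exact_isom aa' a'a rr' r'r _ _ RS).
- by rewrite (left_aug_natural aP) fmor1 comp1m.
- by rewrite -(left_conn_natural dRP dP rP) fmor1 compm1.
Qed.

End LeftDerived.

Arguments left_conn [T I C] F [A] Q d.

Section RightDerived.
Variables (T : triangulated) (I : ideal T) (hI : homological_ideal I).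
Variables (C : abelian) (F : functor (op T) C).

Lemma right_complex (A : T) (P : resolution I A) n :
  comor F (pdiff P n) \oc din (fun k => comor F (pdiff P k)) n = 0.
Proof. by case: n => [|n] /=; rewrite ?compm0 // -comorM pdiffK comor0. Qed.

Section Complexes.
Variables (A A' : T) (P : resolution I A) (P' : resolution I A').

Lemma right_compatible f t n : lifts f P P' t ->
  compatible (din (fun k => comor F (pdiff P' k)) n) (comor F (pdiff P' n))
    (din (fun k => comor F (pdiff P k)) n) (comor F (pdiff P n)) (comor F (t n)).
Proof.
move=> [td _]; split; last by exists (comor F (t n.+1)); rewrite -!comorM td.
case: n => [|n] /=; first by exists 0; rewrite !compm0.
by exists (comor F (t n)); rewrite -!comorM td.
Qed.

Lemma rightD_map_eq f t t' n : lifts f P P' t -> lifts f P P' t' ->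
  rightD_map F n P P' t = rightD_map F n P P' t'.
Proof.
move=> tP tP'; case: n => [|n].
  have [h hE] := lifts_homotopic0 hI tP tP'.
  refine (homology_map_homotopic (h := 0) (k := comor F h) (right_complex P' 0)
    (right_complex P 0) (right_compatible 0 tP) (right_compatible 0 tP') _).
  by rewrite -comorB hE comorM compm0 add0r.
have [h [k hkE]] := lifts_homotopicS hI tP tP' n.
refine (homology_map_homotopic (h := comor F k) (k := comor F h)
  (right_complex P' n.+1) (right_complex P n.+1) (right_compatible n.+1 tP)
  (right_compatible n.+1 tP') _).
by rewrite -comorB hkE comorD !comorM addrC.
Qed.

End Complexes.

Lemma rightD_map1 (A : T) (P : resolution I A) n :
  rightD_map F n P P (fun k => idm _) = idm (rightD F n P).
Proof.
rewrite /rightD_map /cochain_cohomology_map comor1.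
exact: homology_map1 (right_complex P n).
Qed.

Lemma rightD_mapM (A A' A2 : T) (P : resolution I A) (P' : resolution I A')
    (P2 : resolution I A2) g f t' t n :
  lifts f P P' t -> lifts g P' P2 t' ->
  rightD_map F n P P' t \oc rightD_map F n P' P2 t'
    = rightD_map F n P P2 (fun k => t' k \oc t k).
Proof.
move=> tP tP'; rewrite /rightD_map /cochain_cohomology_map comorM.
exact: homology_mapM (right_complex P2 n) (right_complex P' n)
  (right_complex P n) (right_compatible n tP') (right_compatible n tP).
Qed.

Lemma rightD_map_inv (A : T) (P P' : resolution I A) t t' n :
  lifts (idm A) P P' t -> lifts (idm A) P' P t' ->
  rightD_map F n P P' t \oc rightD_map F n P' P t' = idm _.
Proof.
move=> tP tP'; rewrite (rightD_mapM _ tP tP') -rightD_map1.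
by apply: rightD_map_eq (lifts1 P); rewrite -[idm A]comp1m; exact: liftsM.
Qed.

Definition right_aug (A : T) (P : resolution I A) : mor (F A) (rightD F 0 P) :=
  to_homology (din (fun k => comor F (pdiff P k)) 0) (comor F (pdiff P 0))
    (comor F (paug P)).

Definition right_conn (A : T) (Q : resolution I (susp A)) (d : mor A (pobj Q 1)) :
    mor (rightD F 1 Q) (F A) :=
  from_homology (din (fun k => comor F (pdiff Q k)) 1) (comor F (pdiff Q 1))
    (comor F d).

Arguments right_conn [A] Q d.

Lemma right_aug_natural (A A' : T) (P : resolution I A) (P' : resolution I A') f t :
  lifts f P P' t ->
  right_aug P \oc comor F f = rightD_map F 0 P P' t \oc right_aug P'.
Proof.
move=> tP; apply/esym.
refine (to_homology_natural (h := 0) (right_complex P' 0) (right_complex P 0)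
  (right_compatible 0 tP) _ _ _).
- by rewrite -comorM paugK comor0.
- by rewrite -comorM paugK comor0.
- by rewrite -!comorM tP.2 compm0 addr0.
Qed.

Lemma right_conn_natural (A A' : T) (Q : resolution I (susp A))
    (Q' : resolution I (susp A')) d d' f s :
  connecting hI Q d -> connecting hI Q' d' -> lifts (fmor susp f) Q Q' s ->
  right_conn Q d \oc rightD_map F 1 Q Q' s = comor F f \oc right_conn Q' d'.
Proof.
move=> dP dP' sP; have [h hE] := connecting_natural dP dP' sP.
refine (from_homology_natural (k := comor F h) (right_complex Q' 1)
  (right_complex Q 1) (right_compatible 1 sP) _ _ _).
- by rewrite -comorM (connecting_comp0 dP') comor0.
- by rewrite -comorM (connecting_comp0 dP) comor0.
- by rewrite -!comorM hE comorD.
Qed.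

Lemma right_short_exact (A : T) (P : resolution I A) (Q : resolution I (susp A)) d :
  cohomological F -> connecting hI Q d ->
  short_exact (right_conn Q d) (right_aug P).
Proof.
move=> hF dP; have [R [r [dR [R1 tri dI rP _]]]] := dP.
have dRP := connecting_refl hI R1 tri dI.
have [a aP] := lifts_exist hI (idm A) R P.
have [a' aP'] := lifts_exist hI (idm A) P R.
have [r' rP'] := lifts_exist hI (idm (susp A)) Q (susp_res hI R).
have RS : short_exact (right_conn (susp_res hI R) dR) (right_aug R).
  apply: five_term_short_exact.
  - apply: exact_atNl; rewrite -comorN.
    exact: hF ((tri_rot _ _ _).1 ((tri_rot _ _ _).1 tri)).
  - exact: hF ((tri_rot _ _ _).1 tri).
  - exact: hF tri.
  - apply: zobj_tgt; apply: (fmor_zobj F); apply: (@fmor_zobj _ _ susp); exact: R1.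
  - by [].
have [aa' a'a] := (rightD_map_inv 0 aP' aP, rightD_map_inv 0 aP aP').
have [rr' r'r] := (rightD_map_inv 1 rP' rP, rightD_map_inv 1 rP rP').
rewrite -fmor1 in rP rP'.
apply: (short_exact_isom rr' r'r aa' a'a _ _ RS).
- by rewrite (right_conn_natural dP dRP rP') comor1 comp1m.
- by rewrite -(right_aug_natural aP') comor1 compm1.
Qed.

End RightDerived.

Arguments right_conn [T I C] F [A] Q d.

(** * Universal coefficient sequences *)

Section UniversalCoefficients.
Variables (T : triangulated) (I : ideal T) (hI : homological_ideal I).

Definition conn (A : T) (Q : resolution I (susp A)) : mor A (pobj Q 1) :=
  xget 0 [set d | connecting hI Q d]%classic.

Lemma connP (A : T) (Q : resolution I (susp A)) :
  uct_object I A -> connecting hI Q (conn Q).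
Proof.
move=> /connecting_exists -/(_ hI Q)[d dQ].
by rewrite /conn; case: xgetP => [d' _ //|/(_ d)].
Qed.

(** Once [G'] is replaced by the composite, [leftD G' 1 P] is convertible to
    [leftD G 1] of the suspended resolution; the same holds on the right. *)
Lemma left_uct (C : abelian) (G G' : functor T C) :
  homological G -> G' = fcomp G susp ->
  exists (i : forall (A : T) (P : resolution I A), mor (leftD G 0 P) (G A))
         (p : forall (A : T) (P : resolution I A), mor (G A) (leftD G' 1 P)),
    (forall A P, uct_object I A -> short_exact (i A P) (p A P)) /\
    (forall A A' (P : resolution I A) (P' : resolution I A') f t,
      uct_object I A -> uct_object I A' -> lifts f P P' t ->
      i A' P' \oc leftD_map G 0 P P' t = fmor G f \oc i A P /\
      p A' P' \oc fmor G f = leftD_map G' 1 P P' t \oc p A P).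
Proof.
move=> hG ->; exists (fun A P => left_aug G P),
  (fun A P => left_conn G (susp_res hI P) (conn _)); split=> [A P A1|].
  exact (left_short_exact P hG (connP (susp_res hI P) A1)).
move=> A A' P P' f t A1 A1' tP; split; first exact: left_aug_natural.
exact (left_conn_natural G (connP (susp_res hI P) A1)
  (connP (susp_res hI P') A1') (lifts_susp hI tP)).
Qed.

Lemma right_uct (C : abelian) (G G' : functor (op T) C) :
  cohomological G -> G' = fcomp G (fop susp) ->
  exists (i : forall (A : T) (P : resolution I A), mor (rightD G' 1 P) (G A))
         (p : forall (A : T) (P : resolution I A), mor (G A) (rightD G 0 P)),
    (forall A P, uct_object I A -> short_exact (i A P) (p A P)) /\
    (forall A A' (P : resolution I A) (P' : resolution I A') f t,
      uct_object I A -> uct_object I A' -> lifts f P P' t ->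
      i A P \oc rightD_map G' 1 P P' t = comor G f \oc i A' P' /\
      p A P \oc comor G f = rightD_map G 0 P P' t \oc p A' P').
Proof.
move=> hG ->; exists (fun A P => right_conn G (susp_res hI P) (conn _)),
  (fun A P => right_aug G P); split=> [A P A1|].
  exact (right_short_exact P hG (connP (susp_res hI P) A1)).
move=> A A' P P' f t A1 A1' tP; split; last exact: right_aug_natural.
exact (right_conn_natural G (connP (susp_res hI P) A1)
  (connP (susp_res hI P') A1') (lifts_susp hI tP)).
Qed.

End UniversalCoefficients.

Theorem theorem4p4 (T : triangulated) (I : ideal T)
    (hI : homological_ideal I)
    (C : abelian) (F : functor T C) (hF : homological F)
    (Ft : functor (op T) C) (hFt : cohomological Ft) (B : T) :
  [/\ exists (i : forall (n : int) (A : T) (P : resolution I A),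
                mor (leftD (shiftF F n) 0 P) (shiftF F n A))
             (p : forall (n : int) (A : T) (P : resolution I A),
                mor (shiftF F n A) (leftD (shiftF F (n - 1)) 1 P)),
        (forall n A P, uct_object I A -> short_exact (i n A P) (p n A P)) /\
        (forall n A A' (P : resolution I A) (P' : resolution I A')
            (f : mor A A') (t : forall k, mor (pobj P k) (pobj P' k)),
          uct_object I A -> uct_object I A' -> lifts f P P' t ->
          i n A' P' \oc leftD_map (shiftF F n) 0 P P' t
            = fmor (shiftF F n) f \oc i n A P /\
          p n A' P' \oc fmor (shiftF F n) f
            = leftD_map (shiftF F (n - 1)) 1 P P' t \oc p n A P),
      exists (i : forall (n : int) (A : T) (P : resolution I A),
                mor (rightD (coshiftF Ft (n - 1)) 1 P) (coshiftF Ft n A))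
             (p : forall (n : int) (A : T) (P : resolution I A),
                mor (coshiftF Ft n A) (rightD (coshiftF Ft n) 0 P)),
        (forall n A P, uct_object I A -> short_exact (i n A P) (p n A P)) /\
        (forall n A A' (P : resolution I A) (P' : resolution I A')
            (f : mor A A') (t : forall k, mor (pobj P k) (pobj P' k)),
          uct_object I A -> uct_object I A' -> lifts f P P' t ->
          i n A P \oc rightD_map (coshiftF Ft (n - 1)) 1 P P' t
            = comor (coshiftF Ft n) f \oc i n A' P' /\
          p n A P \oc comor (coshiftF Ft n) f
            = rightD_map (coshiftF Ft n) 0 P P' t \oc p n A' P')
    & exists (i : forall (A : T) (Q : resolution I (susp A)),
                mor (Ext 1 Q B) (homF B A))
             (p : forall (A : T) (P : resolution I A),
                mor (homF B A) (Ext 0 P B)),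
        (forall A P Q, uct_object I A -> short_exact (i A Q) (p A P)) /\
        (forall A A' (P : resolution I A) (P' : resolution I A')
            (Q : resolution I (susp A)) (Q' : resolution I (susp A'))
            (f : mor A A') (t : forall k, mor (pobj P k) (pobj P' k))
            (s : forall k, mor (pobj Q k) (pobj Q' k)),
          uct_object I A -> uct_object I A' ->
          lifts f P P' t -> lifts (fmor susp f) Q Q' s ->
          i A Q \oc Ext_map 1 Q Q' B s
            = comor (homF B) f \oc i A' Q' /\
          p A P \oc comor (homF B) f
            = Ext_map 0 P P' B t \oc p A' P')].
Proof.
split.
- pose H n := left_uct hI (shift_homological n hF) (shiftF_pred F n).
  pose i n := projT1 (cid (H n)); pose p n := projT1 (cid (projT2 (cid (H n)))).
  have ipP n := projT2 (cid (projT2 (cid (H n)))).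
  by exists i, p; split=> [n|n]; [exact: (ipP n).1 | exact: (ipP n).2].
- pose H n := right_uct hI (coshift_cohomological n hFt) (coshiftF_pred Ft n).
  pose i n := projT1 (cid (H n)); pose p n := projT1 (cid (projT2 (cid (H n)))).
  have ipP n := projT2 (cid (projT2 (cid (H n)))).
  by exists i, p; split=> [n|n]; [exact: (ipP n).1 | exact: (ipP n).2].
- have hB := homF_cohomological B.
  exists (fun A Q => right_conn (homF B) Q (conn hI Q)), (fun A P => right_aug (homF B) P).
  split=> [A P Q A1|]; first exact: right_short_exact hB (connP hI Q A1).
  move=> A A' P P' Q Q' f t s A1 A1' tP sP; split; last exact: right_aug_natural.
  exact: right_conn_natural (connP hI Q A1) (connP hI Q' A1') sP.
Qed.
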